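(* Let $G$ be a finite simple graph with no isolated edges (i.e., no connected component isomorphic to $K_2$) such that $\Delta(G)\geq 6$ and $\mathrm{mad}(G)<3$. Then $\chi'_\Sigma(G)\leq \Delta(G)+1$.
   Context: For a graph $G=(V,E)$, a proper edge $k$-colouring is a map $c:E\to\{1,\dots,k\}$ such that adjacent edges receive distinct colours. For a vertex $u$, let $s(u)=\sum_{e\ni u}c(e)$ be the sum of colours of edges incident with $u$. A neighbour sum distinguishing (nsd) edge $k$-colouring is a proper edge $k$-colouring with $s(u)\neq s(v)$ for every edge $uv\in E$. The neighbour sum distinguishing index $\chi'_\Sigma(G)$ is the least $k$ for which an nsd edge $k$-colouring of $G$ exists. $\Delta(G)$ is the maximum degree of $G$, and the maximum average degree is $\mathrm{mad}(G)=\max\{2|E(H)|/|V(H)| : H\subseteq G\}$ (over nonempty subgraphs $H$). *)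

(* Defs.v *)
From HB Require Import structures.
From mathcomp Require Import all_boot all_order all_algebra.

Set Implicit Arguments.
Unset Strict Implicit.
Unset Printing Implicit Defensive.

Record sgraph := SGraph {
  vertex :> finType;
  adj : rel vertex;
  adj_sym : symmetric adj;
  adj_irrefl : irreflexive adj }.

Section Graphs.
Variable G : sgraph.

Definition edges : {set {set G}} :=
  [set f | [exists u : G, exists v : G, adj u v && (f == [set u; v])]].

Definition degree (u : G) : nat := #|[set v : G | adj u v]|.

Definition max_degree : nat := \max_(u : G) degree u.

(* The component of u is {u, v}, with u and v adjacent: a copy of K_2. *)
Definition isolated_edge (u v : G) : bool :=
  adj u v && ([set w : G | connect (@adj G) u w] == [set u; v]).

(* Subgraphs are pairs (vertex set, edge set), not necessarily induced. *)
Definition subgraph (H : {set G} * {set {set G}}) : bool :=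
  (H.2 \subset edges) && [forall f in H.2, f \subset H.1].

(* Every ratio is >= 0, so the default 0 matters only if G has no vertices. *)
Definition mad : rat :=
  \big[Num.max/0%R]_(H : {set G} * {set {set G}} | subgraph H && (H.1 != set0))
    (2%:R * #|H.2|%:R / #|H.1|%:R)%R.

(* Colourings are total on {set G}; only their values on edges matter. *)
Definition proper_colouring (k : nat) (c : {set G} -> nat) : Prop :=
  (forall f, f \in edges -> 1 <= c f <= k) /\
  (forall f g, f \in edges -> g \in edges ->
     f != g -> f :&: g != set0 -> c f != c g).

Definition colour_sum (c : {set G} -> nat) (u : G) : nat :=
  \sum_(f in edges | u \in f) c f.

Definition nsd_colouring (k : nat) (c : {set G} -> nat) : Prop :=
  proper_colouring k c /\
  (forall u v : G, adj u v -> colour_sum c u != colour_sum c v).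

(* "chi'_Sigma(G) is defined and equals k": a relation, because graphs with an
   isolated edge have no nsd colouring at all. *)
Definition nsd_index (k : nat) : Prop :=
  (exists c, nsd_colouring k c) /\
  (forall j, (exists c, nsd_colouring j c) -> k <= j).

End Graphs.

(* Main.v *)
(* Idea.  Work with K = Delta + 1 colours in a graph with the fewest edges among
   the sparse graphs of maximum degree at most Delta that cannot be coloured.
   Colour a smaller graph and extend in three steps: (1) uncolour all edges
   whose end degrees add up to at most 5, since these can be coloured greedily at
   the very end (at most 6 colours are forbidden); (2) colour simultaneously the
   edges deleted at one vertex v, where the leaves and the 2-vertices next to v
   give enough freedom to make the colour sum at v avoid the sums of its other
   neighbours; (3) finish greedily.  At a vertex of degree Delta step (2) can only
   fail if the 2-vertices u next to v all forbid the same colour, namely the sum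
   of the other coloured edges at the second neighbour w of u.  If two such w have
   degree 2, joining them by an edge in the smaller graph makes these sums
   different; if w has degree 3, its other two neighbours must have degree at
   least 4.  Moving charge to 2-vertices, from the vertices of degree at least 4
   directly or through such w, then gives average degree at least 3 among the
   vertices that are not leaves. *)

Require Import Defs.
From mathcomp Require Import all_boot all_order all_algebra.
From mathcomp Require Import zify.
From Stdlib Require Import Classical.

Set Implicit Arguments.
Unset Strict Implicit.
Unset Printing Implicit Defensive.

(** * Partial colourings *)

(** Deleting edges may create isolated edges, which no nsd colouring tolerates. Exempting edges at
    leaves from the sum condition makes the class of graphs closed under deletion; the exemption is
    paid back only when the final colouring is transferred to the graph. Moreover, the sum at a
    vertex is not final while edges there are uncoloured, so an uncoloured light edge next to an
    edge postpones the condition on the latter to the greedy end, where it costs one forbidden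
    colour. At a vertex of degree [d] with [n] deleted edges, at least [n + D + 1 - d] colours are
    available. If [d < D], one of them is given up at each edge for its forbidden colour, and the
    surplus [D - d] still yields many sums. If [d = D], only one colour is to spare, and different
    sums arise from the choice of the colour left out; what remains to be found is then a bijection
    that avoids the forbidden colours. *)

Lemma fresh_colour (K : nat) (s : seq nat) :
  size s < K -> exists2 x, 0 < x <= K & x \notin s.
Proof.
move=> lt_sK.
have /allPn[x] : ~~ all (fun x => x \in s) (iota 1 K).
  apply/negP => /allP sub.
  have := uniq_leq_size (iota_uniq 1 K) sub.
  by rewrite size_iota leqNgt lt_sK.
by rewrite mem_iota add1n ltnS => rng xs; exists x.
Qed.

Section PartialColourings.
Variables (V : finType) (K : nat).
Implicit Types (e : rel V) (c : V -> V -> nat) (I : {set V}).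

Definition neighbours e v : {set V} := [set u | e v u].
Definition valence e v := #|neighbours e v|.
Definition total c a := \sum_y c a y.
Definition others_coloured e c a b :=
  forall y, e a y -> y != b -> c a y != 0.

(* Colour [0] means uncoloured.  The last clause is imposed as soon as all
   edges adjacent to [ab] are coloured, even if [ab] itself is not: adding the
   colour of [ab] shifts both totals equally.  Edges with a leaf are exempt,
   since there the totals differ automatically. *)
Record partial_nsd e c : Prop := PartialNsd {
  pnsd_sym : forall a b, c a b = c b a;
  pnsd_edge : forall a b, c a b != 0 -> e a b;
  pnsd_le : forall a b, c a b <= K;
  pnsd_proper : forall a x y, c a x = c a y -> c a x != 0 -> x = y;
  pnsd_sum : forall a b, e a b -> 1 < valence e a -> 1 < valence e b ->
    others_coloured e c a b -> others_coloured e c b a ->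
    total c a != total c b }.

Definition colourable e :=
  exists c, partial_nsd e c /\ forall a b, e a b -> c a b != 0.

Definition recolour c v I (x : V -> nat) a b :=
  if (a == v) && (b \in I) then x b
  else if (b == v) && (a \in I) then x a else c a b.

Lemma recolour_centre c v I x u :
  v \notin I -> recolour c v I x v u = if u \in I then x u else c v u.
Proof.
move=> vI; rewrite /recolour eqxx /=; case: ifP => // uI.
by rewrite (negPf vI) andbF.
Qed.

Lemma recolour_leaf c v I x u y : v \notin I -> u \in I ->
  recolour c v I x u y = if y == v then x u else c u y.
Proof.
move=> vI uI; rewrite /recolour uI andbT.
by have -> : u == v = false by apply: contraNF vI => /eqP <-.
Qed.

Lemma recolour_out c v I x a y :
  a != v -> a \notin I -> recolour c v I x a y = c a y.
Proof. by move=> /negPf av /negPf aI; rewrite /recolour av aI andbF. Qed.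

Section Recolour.
Variables (e : rel V) (c : V -> V -> nat) (v : V) (I : {set V}) (x : V -> nat).
Hypotheses (e_sym : symmetric e) (e_irr : irreflexive e).
Hypothesis c_ok : partial_nsd e c.
Hypothesis I_nbr : forall u, u \in I -> e v u.
Hypothesis I_unc : forall u, u \in I -> c v u = 0.

Local Notation c' := (recolour c v I x).
Let cE := @recolour_centre c v I x.
Let lE := @recolour_leaf c v I x.
Let oE := @recolour_out c v I x.

Lemma star_centre_notin : v \notin I.
Proof. by apply/negP => /I_nbr; rewrite e_irr. Qed.

Lemma recolour_sym a b : c' a b = c' b a.
Proof.
rewrite /recolour; case: ifP => [/andP[/eqP-> bI]|H1].
  by rewrite (negPf star_centre_notin) andbF.
by case: ifP => // H2; exact: pnsd_sym c_ok a b.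
Qed.

Lemma total_centre : total c' v = total c v + \sum_(u in I) x u.
Proof.
rewrite /total (big_mkcond (fun u => u \in I)) -big_split /=; apply: eq_bigr => y _.
by rewrite (cE _ star_centre_notin); case: ifP => [/I_unc ->|]; rewrite ?addn0.
Qed.

Lemma total_leaf u : u \in I -> total c' u = total c u + x u.
Proof.
move=> uI; rewrite /total (bigD1 v) //= [in RHS](bigD1 v) //=.
rewrite (lE _ star_centre_notin) // eqxx (pnsd_sym c_ok u v) (I_unc uI) add0n addnC.
by congr (_ + _); apply: eq_bigr => y /negPf yv; rewrite (lE _ star_centre_notin) // yv.
Qed.

Lemma total_out a : a != v -> a \notin I -> total c' a = total c a.
Proof.
by move=> av aI; rewrite /total; apply: eq_bigr => y _; rewrite oE.
Qed.

Hypothesis x_rng : forall u, u \in I -> 0 < x u <= K.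
Hypothesis x_inj : {in I &, injective x}.
Hypothesis x_centre : forall u y, u \in I -> c v y != x u.
Hypothesis x_leaf : forall u y, u \in I -> c u y != x u.

Lemma recolour_edge a b : c' a b != 0 -> e a b.
Proof.
rewrite /recolour; case: ifP => [/andP[/eqP-> /I_nbr]|_] //.
case: ifP => [/andP[/eqP-> /I_nbr]|_]; first by rewrite e_sym.
exact: pnsd_edge c_ok a b.
Qed.

Lemma recolour_le a b : c' a b <= K.
Proof.
rewrite /recolour; case: ifP => [/andP[_ /x_rng/andP[]]|_] //.
by case: ifP => [/andP[_ /x_rng/andP[]]|_] //; exact: pnsd_le c_ok a b.
Qed.

Lemma recolour_proper a y z : c' a y = c' a z -> c' a y != 0 -> y = z.
Proof.
have [->|av] := eqVneq a v.
  rewrite !(cE _ star_centre_notin); case: ifP => yI; case: ifP => zI.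
  - by move=> xyz _; exact: x_inj.
  - by move=> /esym/eqP; rewrite (negPf (x_centre z yI)).
  - by move=> /eqP; rewrite (negPf (x_centre y zI)).
  - exact: pnsd_proper c_ok v y z.
case: (boolP (a \in I)) => aI; last first.
  by rewrite !oE //; exact: pnsd_proper c_ok a y z.
rewrite !(lE _ star_centre_notin) //; case: eqP => [->|_]; case: eqP => [->|_] //.
- by move=> /esym/eqP; rewrite (negPf (x_leaf z aI)).
- by move=> /eqP; rewrite (negPf (x_leaf y aI)).
- exact: pnsd_proper c_ok a y z.
Qed.

Hypothesis sum_centre_out : forall y, e v y -> y \notin I ->
  1 < valence e v -> 1 < valence e y ->
  others_coloured e c' v y -> others_coloured e c y v ->
  total c v + \sum_(u in I) x u != total c y.
Hypothesis sum_centre_in : forall u, u \in I -> 1 < valence e v -> 1 < valence e u ->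
  others_coloured e c' v u -> others_coloured e c u v ->
  total c v + \sum_(u in I) x u != total c u + x u.
Hypothesis sum_leaf_out : forall u y, u \in I -> e u y -> y != v ->
  y \notin I -> 1 < valence e u -> 1 < valence e y ->
  others_coloured e c' u y -> others_coloured e c y u ->
  total c u + x u != total c y.
Hypothesis sum_leaf_in : forall u y, u \in I -> y \in I -> e u y ->
  total c u + x u != total c y + x y.

Lemma recolour_ok : partial_nsd e c'.
Proof.
split; [exact: recolour_sym | exact: recolour_edge | exact: recolour_le
       | exact: recolour_proper | ].
have vIF := negPf star_centre_notin.
(* Up to exchanging the ends, [main] covers every edge whose condition can change; an edge from [I]
   to [v] is read from [v]. *)
have main a b : e a b -> (a == v) || ((a \in I) && (b != v)) ->
    1 < valence e a -> 1 < valence e b ->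
    others_coloured e c' a b -> others_coloured e c' b a ->
    total c' a != total c' b.
  move=> eab /orP[/eqP av|/andP[aI bv]] da db oa ob.
    rewrite {a}av in eab da oa ob *; rewrite total_centre.
    have bv : b != v by apply: contraTneq eab => ->; rewrite e_irr.
    case: (boolP (b \in I)) => bI.
      rewrite total_leaf //; apply: sum_centre_in => //.
      by move=> y eby yv; have := ob y eby yv; rewrite (lE _ star_centre_notin) // (negPf yv).
    rewrite total_out //; apply: sum_centre_out => //.
    by move=> y eby yv; have := ob y eby yv; rewrite oE.
  rewrite (total_leaf aI); case: (boolP (b \in I)) => bI.
    by rewrite total_leaf //; exact: sum_leaf_in.
  rewrite total_out //; apply: sum_leaf_out => //.
  by move=> y eby yv; have := ob y eby yv; rewrite oE.
move=> a b eab da db oa ob.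
case: (boolP ((a == v) || ((a \in I) && (b != v)))) => [Ha|]; first exact: main.
case: (boolP ((b == v) || ((b \in I) && (a != v)))) => [Hb|].
  by move=> _; rewrite eq_sym; apply: main => //; rewrite e_sym.
rewrite !negb_or !negb_and !negbK => /andP[bv Hb] /andP[av Ha].
rewrite (negPf av) orbF in Hb; rewrite (negPf bv) orbF in Ha.
rewrite !total_out //; apply: (pnsd_sum c_ok) => // y ey yne.
  by have := oa y ey yne; rewrite oE.
by have := ob y ey yne; rewrite oE.
Qed.

End Recolour.

Definition coloured c u : {set V} := [set y | c u y != 0].

(* Enough to avoid: the colours at [u] and [w], and one colour for each
   neighbour in [Yu] and [Yw]; the other neighbours keep another uncoloured
   edge nearby, hence impose nothing yet. *)
Lemma colour_one_edge e c u w (Yu Yw : {set V}) :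
  symmetric e -> irreflexive e -> partial_nsd e c -> e u w -> c u w = 0 ->
  #|coloured c u| + #|coloured c w| + #|Yu| + #|Yw| < K ->
  (forall y, e u y -> y != w -> y \notin Yu ->
     (exists z, [/\ e u z, z != y, z != w & c u z = 0]) \/
     (exists z, [/\ e y z, z != u & c y z = 0])) ->
  (forall y, e w y -> y != u -> y \notin Yw ->
     (exists z, [/\ e w z, z != y, z != u & c w z = 0]) \/
     (exists z, [/\ e y z, z != w & c y z = 0])) ->
  exists2 x, 0 < x & partial_nsd e (recolour c u [set w] (fun => x)).
Proof.
move=> e_sym e_irr c_ok euw cuw cnt Hu Hw.
pose s := [seq c u y | y in coloured c u] ++ [seq c w y | y in coloured c w]
  ++ [seq total c y - total c u | y in Yu]
  ++ [seq total c y - total c w | y in Yw].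
have s_lt : size s < K by rewrite !size_cat !size_image -!addnA in cnt *.
have [x /andP[x0 xK]] := fresh_colour s_lt.
rewrite !mem_cat !negb_or => /and4P[/imageP xu /imageP xw /imageP xyu /imageP xyw].
have x_pos : x != 0 by rewrite -lt0n.
have uw : u != w by apply: contraTneq euw => ->; rewrite e_irr.
have xnu y : c u y != x.
  by apply/negP => /eqP cx; apply: xu; exists y; rewrite ?inE ?cx.
have xnw y : c w y != x.
  by apply/negP => /eqP cx; apply: xw; exists y; rewrite ?inE ?cx.
exists x => //; apply: recolour_ok => //.
- by move=> y /set1P->.
- by move=> y /set1P->.
- by move=> y _; rewrite x0.
- by move=> y z /set1P-> /set1P->.
- by move=> y z /set1P->.
- move=> y euy; rewrite inE => yw _ _ ou oy.
  rewrite big_set1; apply/negP => /eqP tE.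
  have [yY|yY] := boolP (y \in Yu).
    by apply: xyu; exists y => //; rewrite -tE addKn.
  have [[z [euz zy zw cz]]|[z [eyz zu cz]]] := Hu y euy yw yY.
    have := ou z euz zy; by rewrite recolour_centre ?inE // (negPf zw) cz.
  by have := oy z eyz zu; rewrite cz.
- move=> y /set1P-> du dw ou ow; rewrite big_set1 eqn_add2r.
  apply: (pnsd_sum c_ok) => // z euz zw; have := ou z euz zw.
  by rewrite recolour_centre ?inE // (negPf zw).
- move=> w' y /set1P-> ewy yu; rewrite inE => yw _ _ ow oy.
  apply/negP => /eqP tE.
  have [yY|yY] := boolP (y \in Yw).
    by apply: xyw; exists y => //; rewrite -tE addKn.
  have [[z [ewz zy zu cz]]|[z [eyz zw cz]]] := Hw y ewy yu yY.
    have := ow z ewz zy; by rewrite recolour_leaf ?inE // (negPf zu) cz.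
  by have := oy z eyz zw; rewrite cz.
- by move=> a b /set1P-> /set1P->; rewrite e_irr.
Qed.

(** Such an edge meets at most 5 - 2 = 3 others, and each of them forbids two colours: its own, and
    the one that would equate the sums at its far end and at the shared end. *)
Definition light_edge e u w := valence e u + valence e w <= 5.

Hypothesis K7 : 7 <= K.

(** Induction on the number of uncoloured arcs. With all other neighbours in [Yu] and [Yw], the side
    conditions of [colour_one_edge] are void. *)
Lemma colour_light_edges e c : symmetric e -> irreflexive e ->
  partial_nsd e c -> (forall u w, e u w -> c u w = 0 -> light_edge e u w) ->
  colourable e.
Proof.
move=> e_sym e_irr; pose unc c := #|[set p : V * V | e p.1 p.2 && (c p.1 p.2 == 0)]|.
have [n] := ubnP (unc c); elim: n c => // n IHn c; rewrite ltnS => le_n c_ok lt_c.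
have [/existsP[[u w] /andP[/= euw /eqP cuw]]|] :=
    boolP [exists p : V * V, e p.1 p.2 && (c p.1 p.2 == 0)]; last first.
  rewrite negb_exists => /forallP full; exists c; split => // a b eab.
  by have := full (a, b); rewrite /= eab.
have du : 0 < valence e u by apply/card_gt0P; exists w; rewrite inE.
have dw : 0 < valence e w by apply/card_gt0P; exists u; rewrite inE e_sym.
have [|||x x0 c'_ok] := colour_one_edge (Yu := neighbours e u :\ w) (Yw := neighbours e w :\ u)
    e_sym e_irr c_ok euw cuw.
- have le_col p q : e p q -> c p q = 0 -> #|coloured c p| <= #|neighbours e p :\ q|.
    move=> epq cpq; apply: subset_leq_card; apply/subsetP => y; rewrite !inE.
    move=> cy; rewrite (pnsd_edge c_ok cy) andbT.
    by apply: contraNneq cy => ->; rewrite cpq.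
  have ewu : e w u by rewrite e_sym.
  have cwu : c w u = 0 by rewrite (pnsd_sym c_ok).
  have := le_col _ _ euw cuw; have := le_col _ _ ewu cwu.
  have := lt_c u w euw cuw; rewrite /light_edge /valence.
  rewrite (cardsD1 w (neighbours e u)) (cardsD1 u (neighbours e w)) !inE euw ewu /=; lia.
- by move=> y euy yw; rewrite !inE yw euy.
- by move=> y ewy yu; rewrite !inE yu ewy.
have mono a b : recolour c u [set w] (fun=> x) a b = 0 -> c a b = 0.
  rewrite /recolour; case: ifP => [_ x00|_]; first by rewrite x00 in x0.
  by case: ifP => // _ x00; rewrite x00 in x0.
apply: (IHn (recolour c u [set w] (fun=> x))) => //; last first.
  by move=> a b eab /mono; exact: lt_c.
apply: leq_trans le_n; apply: proper_card; apply/properP; split.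
  by apply/subsetP => [[a b]]; rewrite !inE /= => /andP[-> /eqP/mono->].
exists (u, w); rewrite !inE /= euw ?cuw //.
by rewrite /recolour eqxx inE eqxx /= -lt0n.
Qed.

End PartialColourings.

(** * Choosing colours with prescribed sums *)

Lemma seq_max_exists (s : seq nat) : s != [::] ->
  exists2 M, M \in s & forall m, m \in s -> m <= M.
Proof.
elim: s => // a s IH _; case: s IH => [_|b s /(_ isT)[M Ms Mmax]].
  by exists a => [|m]; rewrite ?mem_head // inE => /eqP->.
have [le_aM|lt_Ma] := leqP a M.
  by exists M => [|m]; rewrite inE ?Ms ?orbT // => /orP[/eqP->|/Mmax].
exists a => [|m]; first exact: mem_head.
by rewrite inE => /orP[/eqP->|/Mmax /leq_trans-> //]; rewrite // ltnW.
Qed.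

Lemma uniq_size_escape (s r : seq nat) : uniq s -> size r < size s ->
  exists2 m, m \in s & m \notin r.
Proof.
move=> us lt_rs; have /allPn[m ms mr] : ~~ all (fun m => m \in r) s.
  by apply/negP => /allP /(uniq_leq_size us); rewrite leqNgt lt_rs.
by exists m.
Qed.

Lemma large_element (m : nat) (s : seq nat) : uniq s ->
  (forall a, a \in s -> 0 < a) -> m < size s ->
  exists2 a, a \in s & m < a.
Proof.
move=> us s_pos ms; have [|a as_] := uniq_size_escape us (r := iota 1 m).
  by rewrite size_iota.
rewrite mem_iota (s_pos a as_) add1n ltnS /= -ltnNge => lt_ma.
by exists a.
Qed.

Lemma size_rem_ge (n b : nat) (s : seq nat) :
  n < size s -> n <= size (rem b s).
Proof.
have [bs|bs] := boolP (b \in s); last by rewrite rem_id // => /ltnW.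
by rewrite size_rem // => lt_ns; rewrite -ltnS (ltn_predK lt_ns).
Qed.

Section Choices.
Variable V : finType.
Implicit Types (I : {set V}) (x psi : V -> nat) (L : V -> seq nat).

Lemma sum_override I u x b : u \in I ->
  \sum_(w in I) (if w == u then b else x w) = b + \sum_(w in I :\ u) x w.
Proof.
move=> uI; rewrite (big_setD1 u) //= eqxx; congr (_ + _).
by apply: eq_bigr => w; rewrite !inE => /andP[/negPf->].
Qed.

Lemma inj_override I u x b : {in I :\ u &, injective x} ->
  (forall w, w \in I :\ u -> x w != b) ->
  {in I &, injective (fun w => if w == u then b else x w)}.
Proof.
move=> x_inj xb w w' wI w'I; case: eqP => [->|/eqP wu]; case: eqP => [->|/eqP w'u] //.
- by move=> bE; have := xb w'; rewrite !inE w'u w'I -bE eqxx => /(_ isT).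
- by move=> bE; have := xb w; rewrite !inE wu wI bE eqxx => /(_ isT).
- by apply: x_inj; rewrite !inE ?wu ?w'u.
Qed.

(* The least available colour [b], say at [u], is given to [u] and the others
   are handled by induction; from the largest sum so obtained, increasing only
   the colour at [u] gives [delta] further sums. *)
Lemma many_sums delta L I :
  (forall u, u \in I -> uniq (L u) /\ #|I| + delta <= size (L u)) ->
  exists s : seq nat, [/\ uniq s, size s = (#|I| * delta).+1 &
    forall m, m \in s -> exists x, [/\ {in I &, injective x},
      forall u, u \in I -> x u \in L u & \sum_(u in I) x u = m]].
Proof.
move En: #|I| => n; elim: n L I En => [|n IHn] L I En HL.
  exists [:: 0]; split => // m; rewrite inE => /eqP->.
  have I0 : I = set0 by apply/eqP; rewrite -cards_eq0 En.
  by exists (fun=> 0); split=> [u w||]; rewrite I0 ?inE ?big_set0 // => u; rewrite inE.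
have exb : exists b, [exists u in I, b \in L u].
  have /card_gt0P[u uI] : 0 < #|I| by rewrite En.
  have [_] := HL u uI; case Lu: (L u) => [|b l] // _.
  by exists b; apply/existsP; exists u; rewrite uI Lu mem_head.
have [b /existsP[u1 /andP[u1I bL]] b_min] := ex_minnP exb.
have E1 : #|I :\ u1| = n by have := cardsD1 u1 I; rewrite u1I En; lia.
have [|s' [us' sz' s'P]] := IHn (fun u => rem b (L u)) _ E1.
  move=> u; rewrite !inE => /andP[_ /HL[uL sL]]; split; first exact: rem_uniq.
  exact: size_rem_ge.
have [|M /[dup] Ms' /s'P[x [x_inj xL xM]] Mmax] := @seq_max_exists s'.
  by case: (s') sz'.
have [uL1 sL1] := HL u1 u1I.
pose T := [seq a <- rem b (L u1) | a \notin [seq x u | u in I :\ u1]].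
have TP a : a \in T -> [/\ a \in L u1, b < a & forall u, u \in I :\ u1 -> x u != a].
  rewrite mem_filter mem_rem_uniq // !inE => /and3P[aim ab aL]; split=> //.
    rewrite ltn_neqAle eq_sym ab b_min //.
    by apply/existsP; exists u1; rewrite u1I.
  by move=> u uI; apply: contraNneq aim => <-; exact: image_f.
(* Of the [n + 1 + delta] colours listed at [u1], one is [b] and at most [n] are used by [x]
   elsewhere. *)
have sT : delta <= size T.
  suff le_rem : size (rem b (L u1)) <= size T + #|I :\ u1|.
    by have := leq_trans (@size_rem_ge (n + delta) b _ sL1) le_rem; rewrite E1 addnC leq_add2r.
  rewrite -(size_image x (mem (I :\ u1))) -size_cat.
  apply: uniq_leq_size; first exact: rem_uniq.
  by move=> a aR; rewrite mem_cat mem_filter aR andbT; case: (_ \in _).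
exists ([seq b + m | m <- s'] ++ [seq a + M | a <- take delta T]); split.
- rewrite cat_uniq !map_inj_uniq ?us' ?take_uniq ?filter_uniq ?rem_uniq //=;
    try by move=> ? ?; lia.
  rewrite andbT; apply/hasPn => _ /mapP[a /mem_take /TP[_ ba _] ->].
  by apply/negP => /mapP[m /Mmax]; lia.
- by rewrite size_cat !size_map size_takel // sz'; lia.
- move=> m; rewrite mem_cat => /orP[] /mapP[].
    move=> m' /s'P[y [y_inj yL <-]] ->.
    exists (fun w => if w == u1 then b else y w); split; last exact: sum_override.
      apply: inj_override => // w /[dup]; rewrite {1}inE => /andP[_ wI] /yL.
      by have [uLw _] := HL w wI; rewrite mem_rem_uniq // !inE => /andP[].
    move=> u uI; case: eqP => [->//|/eqP uu1].
    by apply: (mem_rem (x := b)); apply: yL; rewrite !inE uu1.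
  move=> a /mem_take /TP[aL ba ax] ->.
  exists (fun w => if w == u1 then a else x w); split.
  - exact: inj_override.
  - move=> u uI; case: eqP => [->//|/eqP uu1].
    by apply: (mem_rem (x := b)); apply: xL; rewrite !inE uu1.
  - by rewrite sum_override // xM.
Qed.

Lemma avoiding_sums delta L I (r : seq nat) :
  (forall u, u \in I -> uniq (L u) /\ #|I| + delta <= size (L u)) ->
  size r <= #|I| * delta ->
  exists x, [/\ {in I &, injective x}, forall u, u \in I -> x u \in L u
    & \sum_(u in I) x u \notin r].
Proof.
move=> /many_sums[s [us sz sP]] rs.
have [|m /sP[x [x_inj xL <-]] mr] := uniq_size_escape us (r := r).
  by rewrite sz.
by exists x.
Qed.

(** Induction on [I]. If some [psi u0] lies in [B], that colour goes to a vertex where it is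
    allowed; afterwards [psi u0] is no longer in use, so [u0] accepts every remaining colour and the
    hypothesis persists. If no value of [psi] lies in [B], any assignment will do. The sum is fixed
    because all of [B] is used. *)
Lemma derangement psi I (B : seq nat) : uniq B -> size B = #|I| ->
  (forall b, b \in B -> exists2 u, u \in I & psi u != b) ->
  exists x, [/\ {in I &, injective x},
    forall u, u \in I -> x u \in B /\ x u != psi u
    & \sum_(u in I) x u = \sum_(b <- B) b].
Proof.
move En: #|I| => n; elim: n I B En => [|n IHn] I B En uB sB HB.
  have I0 : I = set0 by apply/eqP; rewrite -cards_eq0 En.
  move/size0nil: sB => ->; exists (fun=> 0).
  by split=> [u w||]; rewrite I0 ?inE ?big_set0 ?big_nil // => u; rewrite inE.
suff [u1 [b0 [u1I b0B psi1 HB']]] : exists u1 b0, [/\ u1 \in I, b0 \in B,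
    psi u1 != b0 &
    forall b, b \in rem b0 B -> exists2 u, u \in I :\ u1 & psi u != b].
  have E1 : #|I :\ u1| = n by have := cardsD1 u1 I; rewrite u1I En; lia.
  have [||x [x_inj xB xS]] := IHn _ _ E1 (rem_uniq b0 uB); rewrite ?size_rem ?sB //.
  exists (fun w => if w == u1 then b0 else x w); split.
  - by apply: inj_override => // w /xB[]; rewrite mem_rem_uniq // !inE => /andP[].
  - move=> u uI; case: eqP => [->|/eqP uu1]; first by rewrite eq_sym.
    have uI' : u \in I :\ u1 by rewrite !inE uu1.
    by have [/mem_rem] := xB u uI'.
  - by rewrite sum_override // xS [RHS](big_rem b0).
have [/existsP[u0 /andP[u0I u0B]]|] := boolP [exists u in I, psi u \in B].
  have [u1 u1I u1psi] := HB _ u0B; exists u1, (psi u0); split=> // b.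
  rewrite mem_rem_uniq // !inE => /andP[bpsi bB]; exists u0; last by rewrite eq_sym.
  by rewrite !inE u0I andbT; apply: contraNneq u1psi => <-.
rewrite negb_exists => /forallP noB.
have notB u b : u \in I -> b \in B -> psi u != b.
  by move=> uI bB; have := noB u; rewrite uI; apply: contraNneq => ->.
have /card_gt0P[u1 u1I] : 0 < #|I| by rewrite En.
case EB: B sB => [|b0 B0] // [sB0]; exists u1, b0.
rewrite mem_head; split=> //; first by rewrite notB // EB mem_head.
move=> b; rewrite /= eqxx => bB0.
have /card_gt0P[u uI] : 0 < #|I :\ u1|.
  have := cardsD1 u1 I; rewrite u1I En; case: (B0) sB0 bB0 => //= ? ? ? _; lia.
exists u => //; apply: notB; last by rewrite EB inE bB0 orbT.
by move: uI; rewrite inE => /andP[].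
Qed.

(** Leaving out one colour of [A] gives [#|I| + 1] different sums, one more than [r] can exclude;
    [derangement] realises the chosen one. *)
Lemma avoiding_sums_tight psi I (A r : seq nat) : uniq A -> size A = #|I|.+1 ->
  (forall b, b \in A -> exists2 u, u \in I & psi u != b) -> size r <= #|I| ->
  exists x, [/\ {in I &, injective x},
    forall u, u \in I -> x u \in A /\ x u != psi u
    & \sum_(u in I) x u \notin r].
Proof.
move=> uA sA HA sr; pose S := \sum_(b <- A) b.
have leS b : b \in A -> b <= S by move=> bA; rewrite /S (big_rem b) //= leq_addr.
have [||m /mapP[mu muA ->] mr] := @uniq_size_escape [seq S - b | b <- A] r.
- by rewrite map_inj_in_uniq // => a b /leS aS /leS bS; lia.
- by rewrite size_map sA.
have [||x [x_inj xB xS]] := @derangement psi I (rem mu A) (rem_uniq _ uA).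
- by rewrite size_rem // sA.
- by move=> b /mem_rem/HA.
exists x; split=> //; last by rewrite xS; move: mr; rewrite /S (big_rem mu) //= addKn.
by move=> u /xB[/mem_rem].
Qed.

(** With no sum to avoid, the spare colour removes the obstruction: if [psi] is constantly some
    colour of [A], that is the colour to leave out. *)
Lemma distinct_choice psi I (A : seq nat) : uniq A -> size A = #|I|.+1 ->
  exists x, {in I &, injective x} /\
    forall u, u \in I -> x u \in A /\ x u != psi u.
Proof.
move=> uA sA; pose bad b := [forall u in I, psi u == b].
have okA b : ~~ bad b -> exists2 u, u \in I & psi u != b.
  by rewrite negb_forall => /existsP[u]; rewrite negb_imply => /andP[]; exists u.
have [/hasP[b bA /forallP bad_b]|/hasPn ok] := boolP (has bad A).
  have [||x [x_inj xB _]] := @derangement psi I (rem b A) (rem_uniq _ uA).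
  - by rewrite size_rem // sA.
  - move=> b'; rewrite mem_rem_uniq // !inE => /andP[bb' b'A].
    have [u uI] : exists u, u \in I.
      apply/card_gt0P; case: (A) sA bA b'A => [|p [|q l]] //=; last by lia.
      by rewrite !inE => _ /eqP bp /eqP b'p; rewrite bp b'p eqxx in bb'.
    by exists u; rewrite // eq_sym; have := bad_b u; rewrite uI => /eqP->.
  by exists x; split=> // u /xB[/mem_rem].
have [|x [x_inj xA _]] := @avoiding_sums_tight psi I A [::] uA sA _ isT.
  by move=> b /ok/okA.
by exists x.
Qed.

End Choices.

(** Take two colours of [L1] and three of [L2]. Each of the three exclusions kills at most two of
    the six pairs, so failure forces [x1 = x2] to kill two; then [L1] is contained in [L2], and the
    other pairs realise three different sums, which [r1] and [r2] cannot cover. *)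
Lemma pair_avoiding (L1 L2 : seq nat) r1 r2 : uniq L1 -> uniq L2 ->
  1 < size L1 -> 2 < size L2 ->
  exists x1 x2, [/\ x1 \in L1, x2 \in L2, x1 != x2, x1 + x2 != r1
    & x1 + x2 != r2].
Proof.
case: L1 => [|a [|b L1]] //; case: L2 => [|p [|q [|s L2]]] //.
rewrite /= !inE !negb_or => /andP[/andP[ab _] _].
move=> /and3P[/and3P[pq ps _] /andP[qs _] _] _ _.
have [//|none] := classic (exists x1 x2, [/\ x1 \in [:: a, b & L1],
  x2 \in [:: p, q, s & L2], x1 != x2, x1 + x2 != r1 & x1 + x2 != r2]).
have H x1 x2 : x1 \in [:: a, b & L1] -> x2 \in [:: p, q, s & L2] ->
    [|| x1 == x2, x1 + x2 == r1 | x1 + x2 == r2].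
  move=> x1L x2L; apply/negP => /negP; rewrite !negb_or => /and3P[? ? ?].
  by apply: none; exists x1, x2.
have := H a p; have := H a q; have := H a s; have := H b p; have := H b q.
have := H b s; rewrite !inE !eqxx !orbT /=.
do 6![move=> /(_ isT isT) ?]; lia.
Qed.

(* [x1] is chosen so large that [x1 + y + c > K] for every [y] in the other
   lists. *)
Lemma triple_avoiding K c (L1 L2 L3 : seq nat) gamma beta : 7 <= K -> 0 < c ->
  gamma <= K ->
  (forall L, L \in [:: L1; L2; L3] -> [/\ uniq L, K - 3 <= size L
     & forall a, a \in L -> 0 < a <= K /\ a != c]) ->
  exists x1 x2 x3, [/\ x1 \in L1, x2 \in L2 & x3 \in L3] /\
   [/\ x1 != x2, x1 != x3, x2 != x3, K < x1 + x2 + c & K < x1 + x3 + c] /\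
   x2 + x3 + c != gamma /\ x1 + x2 + x3 != beta.
Proof.
move=> K7 c0 gK HL.
have [u1 s1 r1] := HL L1 (mem_head _ _).
have [u2 s2 r2] : [/\ uniq L2, K - 3 <= size L2
     & forall a, a \in L2 -> 0 < a <= K /\ a != c] by apply: HL; rewrite !inE eqxx orbT.
have [u3 s3 r3] : [/\ uniq L3, K - 3 <= size L3
     & forall a, a \in L3 -> 0 < a <= K /\ a != c] by apply: HL; rewrite !inE eqxx !orbT.
(* As [y != c], the sum [y + c] is at least 3 when [c <= 2], and at least 4 otherwise; this is what
   the two thresholds complement. *)
have [x1 x1L x1big] : exists2 x1, x1 \in L1 & (if c <= 2 then K - 3 else K - 4) < x1.
  have pos a : a \in L1 -> 0 < a by case/r1 => /andP[].
  case: ifP => c2; last by apply: large_element => //; apply: leq_trans s1; lia.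
  (* [L1] alone may be one colour too short. Adding [c] makes up for it, and the large element found
     is not [c], because [c <= 2]. *)
  have [|||a] := @large_element (K - 3) (c :: L1); rewrite /= ?u1 ?andbT.
  - by apply/negP => /r1[_]; rewrite eqxx.
  - by move=> a; rewrite inE => /orP[/eqP->|/pos].
  - by rewrite ltnS.
  by rewrite inE => /orP[/eqP->|aL lt_a]; [lia | exists a].
have far L y : (forall a, a \in L -> 0 < a <= K /\ a != c) -> y \in L ->
    K < x1 + y + c.
  by move=> rL /rL[/andP[y0 yK] yc]; move: x1big; case: ifP; lia.
have [||||x2 [x3 [x2L x3L x23 ng nb]]] :=
    @pair_avoiding (rem x1 L2) (rem x1 L3) (gamma - c) (beta - x1).
- exact: rem_uniq.
- exact: rem_uniq.
- by apply: size_rem_ge; apply: leq_trans s2; lia.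
- by apply: size_rem_ge; apply: leq_trans s3; lia.
move: x2L x3L; rewrite !mem_rem_uniq // !inE => /andP[x21 x2L] /andP[x31 x3L].
exists x1, x2, x3; split=> //; split; last by split; [lia | lia].
split=> //; try by rewrite eq_sym.
  exact: far r2 x2L.
exact: far r3 x3L.
Qed.

(** Three vertices receive colours at least [K - 2], [K - 3] and [K - 4], a fourth one at least 1.
    Omitting any single term leaves at least [(K - 3) + (K - 4) + 1], which exceeds [K] as soon as
    [K >= 7]. *)
Lemma large_choice (V : finType) (I : {set V}) (L : V -> seq nat) K :
  7 <= K -> 4 <= #|I| <= 5 ->
  (forall u, u \in I -> [/\ uniq (L u), K - 2 <= size (L u)
     & forall a, a \in L u -> 0 < a]) ->
  exists x, [/\ {in I &, injective x}, forall u, u \in I -> x u \in L u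
    & forall u, u \in I -> K + x u < \sum_(w in I) x w].
Proof.
move=> K7 /andP[I4 I5] HL.
have /card_gt0P[u1 u1I] : 0 < #|I| by lia.
have c1 := cardsD1 u1 I; rewrite u1I in c1.
have /card_gt0P[u2 u2I] : 0 < #|I :\ u1| by lia.
have c2 := cardsD1 u2 (I :\ u1); rewrite u2I in c2.
have /card_gt0P[u3 u3I] : 0 < #|I :\ u1 :\ u2| by lia.
have c3 := cardsD1 u3 (I :\ u1 :\ u2); rewrite u3I in c3.
set J := I :\ u1 :\ u2 :\ u3 in c3.
have u2I' : u2 \in I by move: u2I; rewrite !inE => /andP[].
have u3I' : u3 \in I by move: u3I; rewrite !inE => /and3P[].
have big u a b : u \in I -> exists2 y, y \in rem b (rem a (L u)) & K - 5 < y.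
  move=> uI; have [uL sL pL] := HL u uI; apply: large_element.
  - by do 2!apply: rem_uniq.
  - by move=> y /mem_rem/mem_rem/pL.
  - by do 2!apply: size_rem_ge; apply: leq_trans sL; lia.
have [x1 x1L x1b] : exists2 y, y \in L u1 & K - 3 < y.
  by have [uL sL pL] := HL u1 u1I; apply: large_element => //; apply: leq_trans sL; lia.
have [x2 x2L x2b] : exists2 y, y \in rem x1 (L u2) & K - 4 < y.
  have [uL sL pL] := HL u2 u2I'; apply: large_element.
  - exact: rem_uniq.
  - by move=> y /mem_rem/pL.
  - by apply: size_rem_ge; apply: leq_trans sL; lia.
have [x3 x3L x3b] := big u3 x1 x2 u3I'.
have JP u : u \in J -> u \in I by rewrite /J !inE => /and4P[].
(* With [delta = 0] and nothing to avoid this is a plain choice of distinct colours: [J] has at most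
   two vertices, and at least [K - 5] colours remain in each list. *)
have [|x [x_inj xL _]] := @avoiding_sums V 0
    (fun u => rem x3 (rem x2 (rem x1 (L u)))) J [::] _ isT.
  move=> u /JP/HL[uL sL _]; split; first by do 3!apply: rem_uniq.
  by do 3!apply: size_rem_ge; apply: leq_trans sL; lia.
have xJ u : u \in J -> [/\ x u \in L u, x u != x1, x u != x2 & x u != x3].
  move=> uJ; have := xL u uJ; have [uL _ _] := HL u (JP u uJ).
  by do 3!rewrite mem_rem_uniq ?rem_uniq // inE /=; case/and4P.
have [uL2 _ _] := HL u2 u2I'; have [uL3 _ _] := HL u3 u3I'.
move: x2L; rewrite mem_rem_uniq // inE => /andP[x21 x2L].
move: x3L; do 2!rewrite mem_rem_uniq ?rem_uniq // inE /=.
move=> /and3P[x32 x31 x3L].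
pose z3 w := if w == u3 then x3 else x w.
pose z2 w := if w == u2 then x2 else z3 w.
pose z w := if w == u1 then x1 else z2 w.
have z3L u : u \in I :\ u1 :\ u2 -> [/\ z3 u \in L u, z3 u != x1 & z3 u != x2].
  move=> uI; rewrite /z3; case: eqP => [->//|/eqP u3'].
  have uJ : u \in J by rewrite /J in_setD1 u3'.
  by have [] := xJ u uJ.
have z2L u : u \in I :\ u1 -> z2 u \in L u /\ z2 u != x1.
  move=> uI; rewrite /z2; case: eqP => [->//|/eqP u2'].
  have uJ : u \in I :\ u1 :\ u2 by rewrite in_setD1 u2'.
  by have [] := z3L u uJ.
have zL u : u \in I -> z u \in L u.
  move=> uI; rewrite /z; case: eqP => [->//|/eqP u1'].
  have uJ : u \in I :\ u1 by rewrite in_setD1 u1'.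
  by have [] := z2L u uJ.
have sumE : \sum_(w in I) z w = x1 + (x2 + (x3 + \sum_(w in J) x w)).
  by rewrite sum_override // sum_override // sum_override.
have /card_gt0P[u4 u4J] : 0 < #|J| by lia.
have u4pos : 0 < x u4 by have [xu4 _ _ _] := xJ _ u4J; have [_ _] := HL _ (JP _ u4J); apply.
exists z; split=> //.
  apply: inj_override => [|w /z2L[]//].
  apply: inj_override => [|w /z3L[]//].
  by apply: inj_override => [|w /xJ[]//].
move=> u uI; rewrite sumE.
have : x u4 <= \sum_(w in J) x w by rewrite (big_setD1 u4) //= leq_addr.
move/(leq_trans u4pos) => S0.
have SJ : u \in J -> x u <= \sum_(w in J) x w.
  by move=> uJ; rewrite (big_setD1 u) //= leq_addr.
rewrite /z /z2 /z3; move: SJ S0; rewrite /J !inE uI andbT.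
move: (\sum_(w in _) x w) (x u) x1b x2b x3b K7; clear.
case: eqP => [_|_]; first by lia.
case: eqP => [_|_]; first by lia.
case: eqP => [_|_]; first by lia.
by move=> S y ? ? ? ? /(_ isT); lia.
Qed.

(** * Bounds on the colour sum at a vertex *)

Section SumBounds.
Variables (V : finType) (K : nat) (e : rel V) (c : V -> V -> nat).
Hypothesis c_edge : forall a b, c a b != 0 -> e a b.

Lemma injective_sum_ge (I : {set V}) (x : V -> nat) :
  {in I &, injective x} -> (forall u, u \in I -> 0 < x u) ->
  'C(#|I|.+1, 2) <= \sum_(u in I) x u.
Proof.
move En: #|I| => n; elim: n I En => // n IHn I En x_inj x_pos.
have [|||_ /imageP[u uI ->] xu] := @large_element n [seq x u | u in I].
- by rewrite map_inj_in_uniq ?enum_uniq // => a b; rewrite !mem_enum; exact: x_inj.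
- by move=> _ /imageP[u uI ->]; exact: x_pos.
- by rewrite size_image En.
have E1 : #|I :\ u| = n by have := cardsD1 u I; rewrite uI En; lia.
rewrite (big_setD1 u) //= binS bin1 addnC leq_add //.
apply: IHn => // [a b|a]; rewrite !inE => /andP[_ aI]; last exact: x_pos.
by case/andP=> _ bI; exact: x_inj.
Qed.

Lemma total_split v y : total c v = c v y + \sum_(z in neighbours e v :\ y) c v z.
Proof.
rewrite /total (bigD1 y) //=; congr (_ + _).
rewrite big_mkcond [RHS]big_mkcond; apply: eq_bigr => z _; rewrite !inE.
case: (z != y) => //=; case: ifP => // nez; apply/eqP/negPn/negP => /c_edge.
by rewrite nez.
Qed.

(** The other edges at [v] carry distinct positive colours, so they contribute at least 1 + 2 + ...
    up to [valence e v - 1]. The colour of [vy] is kept apart because it cancels against [total_le]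
    at [y]. *)
Lemma total_ge v y :
  (forall a b, c v a = c v b -> c v a != 0 -> a = b) ->
  others_coloured e c v y -> e v y -> c v y + 'C(valence e v, 2) <= total c v.
Proof.
move=> inj oc evy; rewrite (total_split v y) leq_add2l.
have <- : #|neighbours e v :\ y|.+1 = valence e v by rewrite /valence (cardsD1 y (neighbours e v)) inE evy.
have pos z : z \in neighbours e v :\ y -> c v z != 0.
  by rewrite !inE => /andP[zy evz]; exact: oc.
apply: injective_sum_ge => [a b /pos a0 _ ab|z /pos]; last by rewrite lt0n.
exact: inj.
Qed.

Lemma total_le v y : (forall a b, c a b <= K) -> e v y ->
  total c v <= c v y + (valence e v).-1 * K.
Proof.
move=> leK evy; rewrite (total_split v y) leq_add2l.
have -> : (valence e v).-1 = #|neighbours e v :\ y|.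
  by rewrite /valence (cardsD1 y (neighbours e v)) inE evy.
by rewrite -sum_nat_const; apply: leq_sum => z _; exact: leK.
Qed.

End SumBounds.

(** * Transferring a colouring between graphs on the same vertices *)

Section Restriction.
Variables (V : finType) (K : nat) (e : rel V).
Hypothesis e_sym : symmetric e.


(** An edge with another edge of [U] at one of its ends is not yet subject to the sum condition. Any
    other edge keeps both neighbourhoods, so its condition is inherited from [e']; if it lies in [U]
    itself, both totals lose the same colour. The relation [e'] may have edges outside [e], which
    permits adding an edge in the smaller graph. *)
Lemma restrict_colouring (e' U : rel V) c' : symmetric U ->
  partial_nsd K e' c' -> (forall a b, e' a b -> c' a b != 0) ->
  (forall a b, e a b -> ~~ U a b -> e' a b) ->
  (forall a b, e a b -> 1 < valence e a -> 1 < valence e b ->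
     [\/ exists y, [/\ e a y, y != b & U a y],
         exists y, [/\ e b y, y != a & U b y] |
         [/\ e' a b, neighbours e' a = neighbours e a & neighbours e' b = neighbours e b]]) ->
  partial_nsd K e (fun a b => if e a b && ~~ U a b then c' a b else 0).
Proof.
move=> U_sym c'_ok full sub dec; set c := fun a b => _.
have cE a b : c a b != 0 -> [/\ e a b, ~~ U a b & c a b = c' a b].
  by rewrite /c; case: ifP => // /andP[].
split.
- move=> a b; rewrite /c e_sym U_sym; case: ifP => // /andP[eba Uab].
  exact: pnsd_sym c'_ok a b.
- by move=> a b /cE[].
- by move=> a b; rewrite /c; case: ifP => // _; exact: pnsd_le c'_ok a b.
- move=> a x y cxy cx0; have [_ _ cx] := cE a x cx0.
  have [_ _ cy] : [/\ e a y, ~~ U a y & c a y = c' a y] by apply: cE; rewrite -cxy.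
  by apply: (pnsd_proper c'_ok (a := a)); rewrite -?cx -?cy.
- move=> a b eab da db oa ob.
  have [[y [eay yb Uay]]|[y [eby ya Uby]]|[e'ab Na Nb]] := dec a b eab da db.
  + by have := oa y eay yb; rewrite /c Uay andbF.
  + by have := ob y eby ya; rewrite /c Uby andbF.
  have tot p q : e p q -> neighbours e' p = neighbours e p -> others_coloured e c p q ->
      total c' p = c' p q + \sum_(z in neighbours e p :\ q) c p z.
    move=> epq Np op; rewrite (total_split (pnsd_edge c'_ok) p q) Np.
    congr (_ + _); apply: eq_bigr => z; rewrite !inE => /andP[zq epz].
    by have /cE[] := op z epz zq.
  have eba : e b a by rewrite e_sym.
  have cedge p q : c p q != 0 -> e p q by case/cE.
  have := pnsd_sum c'_ok e'ab; rewrite /valence Na Nb => /(_ da db).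
  have o' p q : neighbours e' p = neighbours e p -> others_coloured e' c' p q.
    by move=> _ y e'py _; exact: full.
  move=> /(_ (o' _ _ Na) (o' _ _ Nb)); rewrite (tot a b) // (tot b a) //.
  rewrite (total_split cedge a b) (total_split cedge b a).
  rewrite (pnsd_sym c'_ok b a) eqn_add2l /c e_sym U_sym.
  rewrite (pnsd_sym c'_ok b a).
  by rewrite eqn_add2l.
Qed.

End Restriction.

(** * Reducible configurations *)

Section Sparse.
Variable V : finType.
Implicit Type e : rel V.

Definition arcs e : {set V * V} := [set p | e p.1 p.2].
Definition arcs_in e (S : {set V}) : {set V * V} :=
  [set p | [&& p.1 \in S, p.2 \in S & e p.1 p.2]].

(* Both orientations are counted: this is mad < 3. *)
Definition sparse e :=
  forall S : {set V}, S != set0 -> #|arcs_in e S| < 3 * #|S|.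

Lemma sparse_sub e e' : subrel e' e -> sparse e -> sparse e'.
Proof.
move=> sub sp S /sp; apply: leq_ltn_trans; apply: subset_leq_card.
by apply/subsetP => p; rewrite !inE => /and3P[-> -> /sub->].
Qed.

Lemma deg_sub e e' v : subrel e' e -> valence e' v <= valence e v.
Proof.
by move=> sub; apply: subset_leq_card; apply/subsetP => u; rewrite !inE => /sub.
Qed.

End Sparse.

(** Smaller graphs live on the same vertex type: a vertex is removed by deleting its edges, so size
    is measured by arcs. *)
Record minimal_noncolourable (V : finType) (D : nat) (e : rel V) : Prop := {
  min_sym : symmetric e;
  min_irr : irreflexive e;
  min_deg : forall v, valence e v <= D;
  min_sparse : sparse e;
  min_noncolourable : ~ colourable D.+1 e;
  min_smaller : forall e' : rel V, symmetric e' -> irreflexive e' ->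
    (forall v, valence e' v <= D) -> sparse e' -> #|arcs e'| < #|arcs e| ->
    colourable D.+1 e' }.

Section Minimal.
Variables (V : finType) (D : nat) (e : rel V).
Hypothesis D6 : 6 <= D.
Hypothesis e_min : minimal_noncolourable D e.
Let K := D.+1.
Notation deg := (valence e).
Notation nbr := (neighbours e).
Notation light := (light_edge e).

Let e_sym := min_sym e_min.
Let e_irr := min_irr e_min.
Let degD := min_deg e_min.
Let e_sparse := min_sparse e_min.
Let K7 : 7 <= K := D6.

Lemma minimal_finish c : partial_nsd K e c ->
  (forall u w, e u w -> c u w = 0 -> light u w) -> False.
Proof.
move=> c_ok c_light; apply: (min_noncolourable e_min).
exact: colour_light_edges c_light.
Qed.

Lemma light_sym : symmetric light.
Proof. by move=> a b; rewrite /light_edge addnC. Qed.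

(** Only [F] is deleted, but all of [U] ends up uncoloured. The smaller graph says nothing about the
    sums at the ends of a deleted edge, so unless one end is a leaf, another edge of [U] must adjoin
    it. *)
Lemma minimal_delete (F U : rel V) : symmetric F -> symmetric U -> subrel F U ->
  (exists a b, e a b && F a b) ->
  (forall a b, e a b -> F a b -> 1 < deg a -> 1 < deg b ->
     (exists y, [/\ e a y, y != b & U a y]) \/
     (exists y, [/\ e b y, y != a & U b y])) ->
  exists c, partial_nsd K e c /\ forall a b, (c a b != 0) = e a b && ~~ U a b.
Proof.
move=> F_sym U_sym FU [a0 [b0 /andP[eab0 Fab0]]] undec.
pose e' := fun a b => e a b && ~~ F a b.
have sub : subrel e' e by move=> a b /andP[].
have e'_sym : symmetric e' by move=> a b; rewrite /e' e_sym F_sym.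
have [|v|||c' [c'_ok full]] := min_smaller e_min e'_sym.
- by move=> a; rewrite /e' e_irr.
- exact: leq_trans (deg_sub v sub) (degD v).
- exact: sparse_sub e_sparse.
- apply: proper_card; apply/properP; split.
    by apply/subsetP => p; rewrite !inE => /sub.
  by exists (a0, b0); rewrite !inE //= /e' Fab0 andbF.
exists (fun a b => if e a b && ~~ U a b then c' a b else 0); split; last first.
  move=> a b; case: ifP => // /andP[eab Uab]; rewrite full // /e' eab.
  by apply: contra Uab => /FU.
apply: (restrict_colouring e_sym U_sym c'_ok full).
  by move=> a b eab; rewrite /e' eab; apply: contra => /FU.
move=> a b eab da db.
have [/existsP[y /and3P[? ? ?]]|] :=
    boolP [exists y, [&& e a y, y != b & U a y]]; first by constructor 1; exists y.
have [/existsP[y /and3P[? ? ?]] _|nb na] :=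
    boolP [exists y, [&& e b y, y != a & U b y]]; first by constructor 2; exists y.
have noU p q y : ~~ [exists y, [&& e p y, y != q & U p y]] -> e p y -> y != q ->
    ~~ U p y.
  move=> nex epy yq; apply: contra nex => Upy.
  by apply/existsP; exists y; rewrite epy yq.
have NFab : ~~ F a b.
  apply/negP => Fab; have [[y []]|[y []]] := undec a b eab Fab da db.
    by move=> eay yb; apply/negP; exact: noU na eay yb.
  by move=> eby ya; apply/negP; exact: noU nb eby ya.
have nbrE p q : ~~ F p q -> ~~ [exists y, [&& e p y, y != q & U p y]] ->
    neighbours e' p = nbr p.
  move=> NF nU; apply/setP => y; rewrite !inE /e'; case epy: (e p y) => //=.
  have [->//|yq] := eqVneq y q.
  by apply: contra (noU p q y nU epy yq) => /FU.
by constructor 3; rewrite /e' eab NFab (nbrE a b) // (nbrE b a) // F_sym.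
Qed.

Definition star v (I : {set V}) : rel V :=
  fun a b => ((a == v) && (b \in I)) || ((b == v) && (a \in I)).

Lemma star_sym v I : symmetric (star v I).
Proof. by move=> a b; rewrite /star orbC. Qed.

Lemma starE v (I : {set V}) u : v \notin I -> star v I v u = (u \in I).
Proof. by move=> vI; rewrite /star eqxx (negPf vI) andbF orbF. Qed.

(** [X] allows a further edge to be left uncoloured on purpose, to postpone a sum condition away
    from [v]. *)
Definition uncoloured_exactly c v (I : {set V}) (X : rel V) :=
  forall a b, (c a b != 0) = [&& e a b, ~~ star v I a b, ~~ light a b & ~~ X a b].

Lemma star_start v (I : {set V}) (X : rel V) : symmetric X -> I \subset nbr v ->
  I != set0 ->
  (forall u, u \in I -> [\/ deg u <= 1, exists2 w, w \in I & w != u |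
     exists2 w, e u w & (w != v) && light u w]) ->
  exists2 c, partial_nsd K e c & uncoloured_exactly c v I X.
Proof.
move=> X_sym /subsetP I_nbr /set0Pn[u0 u0I] undec.
have evI u : u \in I -> e v u by move/I_nbr; rewrite inE.
have vI : v \notin I by apply/negP => /evI; rewrite e_irr.
have [|||||c [c_ok cE]] := @minimal_delete (star v I)
    (fun a b => [|| star v I a b, light a b | X a b]).
- exact: star_sym.
- by move=> a b; rewrite star_sym light_sym X_sym.
- by move=> a b ->.
- by exists v, u0; rewrite evI ?starE.
- have main u : u \in I -> 1 < deg u ->
      (exists y, [/\ e v y, y != u & [|| star v I v y, light v y | X v y]]) \/
      (exists y, [/\ e u y, y != v & [|| star v I u y, light u y | X u y]]).
    move=> uI du; have [|[w wI wu]|[w euw /andP[wv luw]]] := undec u uI.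
    + by rewrite leqNgt du.
    + by left; exists w; rewrite evI ?starE ?wI.
    + by right; exists w; rewrite euw wv luw orbT.
  move=> a b _ /orP[] /andP[/eqP-> uI] da db; first exact: main.
  by have [H|H] := main a uI da; [right | left].
exists c => // a b; rewrite cE; congr (_ && _).
by rewrite !negb_or.
Qed.

Section StarExtend.
Variables (c : V -> V -> nat) (v : V) (I : {set V}) (X : rel V).
Hypothesis c_ok : partial_nsd K e c.
Hypothesis cE : uncoloured_exactly c v I X.
Hypothesis I_nbr : I \subset nbr v.

Lemma star_nbr u : u \in I -> e v u.
Proof. by move=> uI; have := subsetP I_nbr u uI; rewrite inE. Qed.

Lemma star_centre : v \notin I.
Proof. by apply/negP => /star_nbr; rewrite e_irr. Qed.

Lemma star_uncoloured u : u \in I -> c v u = 0.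
Proof.
by move=> uI; apply/eqP; rewrite -[_ == _]negbK cE starE ?star_centre // uI andbF.
Qed.

Lemma light_uncoloured a b : light a b -> c a b = 0.
Proof. by move=> lab; apply/eqP; rewrite -[_ == _]negbK cE lab !andbF. Qed.

Definition available : seq nat :=
  [seq a <- iota 1 K | a \notin [seq c v y | y in nbr v :\: I]].

Lemma available_uniq : uniq available.
Proof. by rewrite filter_uniq ?iota_uniq. Qed.

Lemma availableP a : a \in available -> 0 < a <= K /\ forall y, c v y != a.
Proof.
rewrite mem_filter mem_iota add1n ltnS => /andP[na /andP[a0 aK]].
rewrite a0 aK; split=> // y; apply: contraNneq na => cy.
have cy0 : c v y != 0 by rewrite cy -lt0n.
rewrite -cy; apply: image_f; rewrite !inE (pnsd_edge c_ok cy0) andbT.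
by apply: contraNN cy0 => /star_uncoloured->.
Qed.

Lemma size_available : D.+1 + #|I| <= size available + deg v.
Proof.
have : size (iota 1 K) <= size available + size [seq c v y | y in nbr v :\: I].
  rewrite -size_cat; apply: uniq_leq_size; first exact: iota_uniq.
  by move=> a aK; rewrite mem_cat mem_filter aK andbT; case: (_ \in _).
rewrite size_iota size_image /valence -(cardsID I (nbr v)) (setIidPr I_nbr) /K.
lia.
Qed.

Variable x : V -> nat.
Hypothesis x_av : forall u, u \in I -> x u \in available.
Hypothesis x_inj : {in I &, injective x}.
Hypothesis x_leaf : forall u y, u \in I -> c u y != x u.

(** Each condition offers ways of meeting it: the inequality itself, an uncoloured edge that
    postpones it, a leaf, or the far case. In the far case the other edges at [v] contribute at
    least ['C(deg v, 2)], those at [y] at most [(deg y).-1 * K]. *)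
Lemma star_extend :
  (forall y, e v y -> y \notin I ->
     [\/ total c v + \sum_(u in I) x u != total c y,
         (deg y).-1 * K < 'C(deg v, 2) |
         exists z, [/\ e y z, z != v & c y z = 0]]) ->
  (forall u, u \in I ->
     [\/ deg u <= 1, exists z, [/\ e u z, z != v & c u z = 0] |
         total c v + \sum_(u in I) x u != total c u + x u]) ->
  (forall u y, u \in I -> e u y -> y != v -> y \notin I ->
     [\/ total c u + x u != total c y,
         exists z, [/\ e u z, z != y, z != v & c u z = 0] |
         exists z, [/\ e y z, z != u & c y z = 0]]) ->
  (forall u y, u \in I -> y \in I -> e u y ->
     total c u + x u != total c y + x y) ->
  partial_nsd K e (recolour c v I x).
Proof.
move=> c_out c_in l_out l_in.
have x_rng u : u \in I -> 0 < x u <= K by move=> /x_av/availableP[].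
have x_centre u y : u \in I -> c v y != x u.
  by move=> /x_av/availableP[_]; apply.
apply: recolour_ok => //.
- exact: star_nbr.
- exact: star_uncoloured.
- move=> y evy yI dv dy ov oy.
  have [//|far|[z [eyz zv cz]]] := c_out y evy yI; last first.
    by have := oy z eyz zv; rewrite cz.
  have vy : y != v by apply: contraTneq evy => ->; rewrite e_irr.
  have := @total_ge V e (recolour c v I x) _ v y _ ov evy.
  rewrite (@total_centre _ e _ _ _ _ e_irr star_nbr star_uncoloured).
  rewrite recolour_centre ?star_centre // (negPf yI) => ge.
  have eyv : e y v by rewrite e_sym.
  have := total_le (pnsd_edge c_ok) (pnsd_le c_ok) eyv.
  rewrite (pnsd_sym c_ok y v) => le; apply/eqP => E; move: ge; rewrite E => ge.
  have : c v y + 'C(deg v, 2) <= c v y + (deg y).-1 * K.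
    apply: leq_trans le; apply: ge.
      exact: recolour_edge e_sym c_ok star_nbr.
    by apply: (recolour_proper e_irr c_ok star_nbr).
  by rewrite leq_add2l leqNgt far.
- move=> u uI dv du ov ou; have [|[z [euz zv cz]]|//] := c_in u uI.
    by rewrite leqNgt du.
  by have := ou z euz zv; rewrite cz.
- move=> u y uI euy yv yI du dy ou oy.
  have [//|[z [euz zy zv cz]]|[z [eyz zu cz]]] := l_out u y uI euy yv yI.
    by have := ou z euz zy; rewrite recolour_leaf ?star_centre // (negPf zv) cz.
  by have := oy z eyz zu; rewrite cz.
Qed.

Lemma recoloured_uncoloured a b : e a b -> recolour c v I x a b = 0 ->
  light a b || X a b.
Proof.
move=> eab; rewrite /recolour; case: ifP => [/andP[_ bI] x0|n1].
  by have [] := availableP (x_av bI); rewrite x0.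
case: ifP => [/andP[_ aI] x0|n2].
  by have [] := availableP (x_av aI); rewrite x0.
move=> /eqP; rewrite -[_ == _]negbK cE eab /star n1 n2 /=.
by rewrite negb_and !negbK.
Qed.

End StarExtend.

Notation no_rel := (fun _ _ : V => false).

Lemma no_rel_sym : symmetric (no_rel : rel V). Proof. by []. Qed.

(** Otherwise [uv] is light: once it is deleted, only light edges are uncoloured and the greedy step
    finishes. *)
Lemma leaf_nbr_deg v u : e v u -> deg u = 1 -> 5 <= deg v.
Proof.
move=> evu du; rewrite leqNgt; apply/negP => dv.
have [||u'|c c_ok cE] := @star_start v [set u] no_rel no_rel_sym.
- by apply/subsetP => y /set1P->; rewrite inE.
- by apply/set0Pn; exists u; rewrite inE.
- by move=> /set1P->; constructor 1; rewrite du.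
apply: (minimal_finish c_ok) => a b eab /eqP; rewrite -[_ == _]negbK cE eab /=.
rewrite andbT negb_and !negbK => /orP[/orP[] /andP[/eqP-> /set1P->]|//].
  by rewrite /light_edge du; lia.
by rewrite /light_edge du; lia.
Qed.

(** Otherwise both edges at [u] are light, and deleting them together lets each postpone the
    condition on the other. *)
Lemma deg2_nbr u v w : deg u = 2 -> e u v -> e u w -> v != w ->
  deg v <= 3 -> 4 <= deg w.
Proof.
move=> du euv euw vw dv; rewrite leqNgt; apply/negP => dw.
have [||u'|c c_ok cE] := @star_start u [set v; w] no_rel no_rel_sym.
- by apply/subsetP => y /set2P[]->; rewrite inE.
- by apply/set0Pn; exists v; rewrite !inE eqxx.
- move=> /set2P[]->; constructor 2; first by exists w; rewrite ?inE ?eqxx ?orbT // eq_sym.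
  by exists v; rewrite ?inE ?eqxx.
apply: (minimal_finish c_ok) => a b eab /eqP; rewrite -[_ == _]negbK cE eab /=.
rewrite andbT negb_and !negbK => /orP[/orP[] /andP[/eqP-> /set2P[]->]|//];
  by rewrite /light_edge du; lia.
Qed.

(* The second neighbour of a 2-vertex [u]; the junk value is [u] itself. *)
Definition other v u := odflt u [pick w | e u w && (w != v)].

Lemma otherP v u : e v u -> deg u = 2 ->
  [/\ e u (other v u), other v u != v &
      forall y, e u y -> y != v -> y = other v u].
Proof.
move=> evu du; have euv : e u v by rewrite e_sym.
have c1 : #|nbr u :\ v| = 1.
  by move: du; rewrite /valence (cardsD1 v) inE euv add1n => -[].
have /cards1P[w nE] : #|nbr u :\ v| == 1 by rewrite c1.
have inw y : (e u y && (y != v)) = (y == w).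
  by rewrite -[RHS]in_set1 -nE !inE andbC.
have -> : other v u = w.
  by rewrite /other; case: pickP => [z|/(_ w)]; rewrite inw ?eqxx // => /eqP->.
have /andP[euw wv] : e u w && (w != v) by rewrite inw.
by split=> // y euy yv; apply/eqP; rewrite -inw euy.
Qed.

Definition leaves v := [set u in nbr v | deg u == 1].
Definition bad2 v := [set u in nbr v | (deg u == 2) && (deg (other v u) <= 3)].
Definition good2 v := [set u in nbr v | (deg u == 2) && (4 <= deg (other v u))].
(* Such a vertex passes charge from its two large neighbours to its
   2-neighbour. *)
Definition tstar w :=
  [&& deg w == 3, #|[set y in nbr w | deg y == 2]| == 1
    & #|[set y in nbr w | 4 <= deg y]| == 2].
Definition tstars v := [set u in nbr v | tstar u].
(** When the star is deleted, a weak vertex has no coloured edge left: its other edge, if any, is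
    light. Hence its total will be just the colour it receives, and at most one colour is forbidden
    to it. *)
Definition weak v := leaves v :|: bad2 v.
Definition solid v := [set u in nbr v | (3 <= deg u) && ~~ tstar u].
Definition heavy v := [set u in nbr v | 4 <= deg u].

Lemma tstar_nbr w : tstar w -> exists2 u, e w u & deg u = 2.
Proof.
case/and3P=> _ /cards1P[u uE] _; exists u.
  by have := set11 u; rewrite -uE !inE => /andP[].
by have := set11 u; rewrite -uE !inE => /andP[_ /eqP].
Qed.

Lemma nbr_gt0 v u : e v u -> 0 < deg u.
Proof. by move=> evu; apply/card_gt0P; exists v; rewrite inE e_sym. Qed.

Lemma nbr_partition v :
  deg v = #|weak v| + #|good2 v| + #|tstars v| + #|solid v|.
Proof.
have disj (A B : {set V}) : [disjoint A & B] -> #|A :|: B| = #|A| + #|B|.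
  by rewrite -setI_eq0 => /eqP dAB; rewrite cardsU dAB cards0 subn0.
have tdeg u : tstar u -> deg u = 3 by case/and3P=> /eqP.
rewrite -!disj.
- rewrite /valence; apply: eq_card => u; rewrite !inE; case evu: (e v u) => //=.
  have := nbr_gt0 evu; case du: (deg u) => [|[|[|n]]] //= _.
    by case: leqP => // ->; rewrite orbT.
  by case: (tstar u); rewrite ?orbT ?orbF.
- apply/pred0P => u /=; rewrite !inE; case: (e v u) => //=.
  case du: (deg u) => [|[|[|n]]] //=; rewrite ?andbF //.
  by case: (tstar u); rewrite ?andbF.
- apply/pred0P => u /=; rewrite !inE; case: (e v u) => //=.
  case tu: (tstar u); rewrite ?andbF // (tdeg u tu) //=.
- apply/pred0P => u /=; rewrite !inE; case: (e v u) => //=.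
  by case: (deg u) => [|[|[|n]]] //=; case: leqP.
Qed.

Lemma weak_nbr v : weak v \subset nbr v.
Proof. by apply/subsetP => u; rewrite !inE => /orP[]/andP[]. Qed.

Lemma weakP v u : u \in weak v -> deg u = 1 \/
  [/\ deg u = 2, light u (other v u), e u (other v u), other v u != v &
      forall y, e u y -> y != v -> y = other v u].
Proof.
rewrite !inE => /orP[] /andP[evu]; first by move/eqP; left.
case/andP=> /eqP du dw; right; have [euw wv uniq_w] := otherP evu du.
by split=> //; rewrite /light_edge du.
Qed.

Lemma deg1_nbr u v y : deg u = 1 -> e u v -> e u y -> y = v.
Proof.
move=> du euv euy; have /cards1P[z zE] : #|nbr u| == 1 by rewrite -/(deg u) du.
have in_z a : e u a -> a = z by move=> eua; apply/set1P; rewrite -zE inE.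
by rewrite (in_z y euy) (in_z v euv).
Qed.

Section WeakExtend.
Variables (c : V -> V -> nat) (v : V) (X : rel V).
Hypothesis c_ok : partial_nsd K e c.
Hypothesis cE : uncoloured_exactly c v (weak v) X.
Hypothesis v4 : 4 <= deg v.

Lemma weak_row u y : u \in weak v -> c u y = 0.
Proof.
move=> uI; have evu : e v u := star_nbr (weak_nbr v) uI.
have [->|yv] := eqVneq y v.
  by rewrite (pnsd_sym c_ok) (star_uncoloured cE (weak_nbr v)).
have [euy|/negPf neuy] := boolP (e u y); last first.
  by apply/eqP/negPn/negP => /(pnsd_edge c_ok); rewrite neuy.
have [du|[du luw _ _ uniq_w]] := weakP uI.
  have euv : e u v by rewrite e_sym.
  by rewrite (deg1_nbr du euv euy) eqxx in yv.
by rewrite (uniq_w y) //; apply: light_uncoloured cE _ _ luw.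
Qed.

Lemma weak_total u : u \in weak v -> total c u = 0.
Proof. by move=> uI; rewrite /total big1 // => y _; exact: weak_row. Qed.

(** At a weak 2-vertex [u] the light edge to [w = other v u] postpones the condition on [uv]. The
    edge [uw] only requires [x u] to differ from the total at [w]; if [w] is weak too, distinctness
    of the new colours ensures this. A neighbour satisfying [tstar] is harmless because its edge to
    its 2-neighbour is light. *)
Lemma weak_extend x :
  (forall u, u \in weak v -> x u \in available c v (weak v)) ->
  {in weak v &, injective x} ->
  (forall u, u \in weak v -> deg u = 2 -> other v u \notin weak v ->
     x u != total c (other v u) \/
     exists z, [/\ e (other v u) z, z != u & c (other v u) z = 0]) ->
  (forall y, e v y -> y \notin weak v ->
     [\/ total c v + \sum_(u in weak v) x u != total c y,
         (deg y).-1 * K < 'C(deg v, 2) | tstar y]) ->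
  partial_nsd K e (recolour c v (weak v) x).
Proof.
move=> x_av x_inj x_far Q.
have x_pos u : u \in weak v -> 0 < x u.
  by move=> /x_av/(availableP c_ok cE (weak_nbr v))[/andP[]].
apply: (star_extend c_ok cE (weak_nbr v)) => //.
- by move=> u y uI; rewrite weak_row // eq_sym -lt0n x_pos.
- move=> y evy yI; have [?|?|ty] := Q y evy yI; [exact: Or31 | exact: Or32 |].
  apply: Or33; have [z eyz dz] := tstar_nbr ty; exists z; split=> //.
    by apply: contraTneq v4 => <-; rewrite dz.
  apply: light_uncoloured cE _ _ _; case/and3P: ty => /eqP dy _ _.
  by rewrite /light_edge dy dz.
- move=> u uI; have [du|[du luw euw wv _]] := weakP uI; first by apply: Or31; rewrite du.
  by apply: Or32; exists (other v u); rewrite weak_row.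
- move=> u y uI euy yv yI; rewrite weak_total // add0n.
  have [du|[du luw euw wv uniq_w]] := weakP uI.
    have euv : e u v by rewrite e_sym (star_nbr (weak_nbr v)).
    by rewrite (deg1_nbr du euv euy) eqxx in yv.
  rewrite (uniq_w y) // in yI *; have [?|?] := x_far u uI du yI.
    exact: Or31.
  exact: Or33.
- move=> u y uI yI euy; rewrite !weak_total // !add0n.
  apply: contraTneq euy => /x_inj-> //; by rewrite e_irr.
Qed.

End WeakExtend.

Lemma weak_start v X : symmetric X -> 0 < #|weak v| ->
  exists2 c, partial_nsd K e c & uncoloured_exactly c v (weak v) X.
Proof.
move=> X_sym t0; apply: star_start => //; first exact: weak_nbr.
  by rewrite -card_gt0.
move=> u uI; have [du|[du luw euw wv _]] := weakP uI; first by apply: Or31; rewrite du.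
by apply: Or33; exists (other v u); rewrite // wv.
Qed.

(** [Q] collects the neighbours whose sums have to be avoided. After the colour forbidden by the
    second neighbour is dropped, each list still exceeds [#|weak v|] by [D - deg v], so
    [avoiding_sums] would succeed if [Q] were smaller than claimed. *)
Lemma weak_few v (Q : {set V}) : 4 <= deg v -> 0 < #|weak v| ->
  (forall y, e v y -> y \notin weak v -> y \notin Q ->
     tstar y \/ deg y = 2 /\ K < 'C(deg v, 2)) ->
  #|weak v| * (D - deg v) < #|Q|.
Proof.
move=> v4 t0 Qv; rewrite ltnNge; apply/negP => sQ.
have [c c_ok cE] := weak_start no_rel_sym t0.
pose L u := rem (total c (other v u)) (available c v (weak v)).
have [||x [x_inj xL xS]] := @avoiding_sums V (D - deg v) L (weak v)
   [seq total c y - total c v | y in Q].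
- move=> u _; split; first by rewrite rem_uniq ?available_uniq.
  apply: size_rem_ge; have := size_available c (weak_nbr v).
  have := degD v; lia.
- by rewrite size_image.
have uav := available_uniq c v (weak v).
have xav u : u \in weak v -> x u \in available c v (weak v).
  by move=> /xL/mem_rem.
apply: (minimal_finish (c := recolour c v (weak v) x)).
  apply: (weak_extend c_ok cE v4) => // [u uI _ _|y evy yI].
    by left; have := xL u uI; rewrite mem_rem_uniq // inE => /andP[].
  have [yQ|yQ] := boolP (y \in Q).
    apply: Or31; apply: contraNneq xS => E; apply/imageP; exists y => //.
    by rewrite -E addKn.
  have [ty|[dy far]] := Qv y evy yI yQ; first exact: Or33.
  by apply: Or32; rewrite dy mul1n.
move=> a b eab /(recoloured_uncoloured c_ok cE (weak_nbr v) xav eab).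
by rewrite orbF.
Qed.

(** The comparison is [2 * (D + 1) < D * (D - 1) / 2], which holds exactly from [D = 6] on. *)
Lemma max_deg_far v y : deg v = D -> deg y <= 3 ->
  (deg y).-1 * K < 'C(deg v, 2).
Proof.
move=> dv dy; rewrite dv bin2 geq_half_double /K.
have : (deg y).-1 * D.+1 <= 2 * D.+1 by rewrite leq_mul2r; lia.
nia.
Qed.

(** * Vertices of maximum degree *)

Section MaxDegree.
Variable v : V.
Hypothesis vD : deg v = D.

Let v4 : 4 <= deg v. Proof. by rewrite vD; lia. Qed.

Lemma max_deg_available c : #|weak v| < size (available c v (weak v)).
Proof. by have := size_available c (weak_nbr v); rewrite vD; lia. Qed.

(** By [max_deg_far] only heavy neighbours can share the sum of [v]. Without them no sum is to be
    avoided, and one spare colour suffices even if all forbidden colours agree. *)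
Lemma max_deg_heavy : 0 < #|weak v| -> 0 < #|heavy v|.
Proof.
move=> t0; rewrite lt0n; apply/negP => /eqP/cards0_eq no_heavy.
have [c c_ok cE] := weak_start no_rel_sym t0.
pose A := take #|weak v|.+1 (available c v (weak v)).
have [||x [x_inj xA]] := @distinct_choice V (fun u => total c (other v u)) (weak v) A.
- by rewrite take_uniq ?available_uniq.
- by rewrite size_takel // max_deg_available.
have xav u : u \in weak v -> x u \in available c v (weak v).
  by move=> /xA[/mem_take].
apply: (minimal_finish (c := recolour c v (weak v) x)).
  apply: (weak_extend c_ok cE v4) => // [u uI _ _|y evy yI]; first by left; case: (xA u uI).
  apply: Or32; apply: max_deg_far => //; rewrite leqNgt; apply/negP => dy.
  by have := in_set0 y; rewrite -no_heavy !inE evy dy.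
move=> a b eab /(recoloured_uncoloured c_ok cE (weak_nbr v) xav eab).
by rewrite orbF.
Qed.

Hypothesis few_heavy : #|heavy v| <= #|weak v|.

(** [psi] may take any value where the second neighbour imposes nothing yet; this freedom serves to
    make it nonconstant. The last clause lets edges left uncoloured away from [v] be recognised
    afterwards. *)
Lemma max_deg_extend c X psi : partial_nsd K e c ->
  uncoloured_exactly c v (weak v) X ->
  (forall b, 0 < b -> exists2 u, u \in weak v & psi u != b) ->
  (forall u, u \in weak v -> deg u = 2 -> other v u \notin weak v ->
     psi u = total c (other v u) \/
     exists z, [/\ e (other v u) z, z != u & c (other v u) z = 0]) ->
  exists c', [/\ partial_nsd K e c',
    forall a b, e a b -> c' a b = 0 -> light a b || X a b &
    forall a b, a != v -> b != v -> c' a b = c a b].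
Proof.
move=> c_ok cE psi_ne psiE; pose A := take #|weak v|.+1 (available c v (weak v)).
have av_pos b : b \in available c v (weak v) -> 0 < b.
  by move=> /(availableP c_ok cE (weak_nbr v))[/andP[]].
have [||||x [x_inj xA xS]] := @avoiding_sums_tight V psi (weak v) A
    [seq total c y - total c v | y in heavy v].
- by rewrite take_uniq ?available_uniq.
- by rewrite size_takel // max_deg_available.
- by move=> b /mem_take/av_pos/psi_ne.
- by rewrite size_image.
have xav u : u \in weak v -> x u \in available c v (weak v).
  by move=> /xA[/mem_take].
exists (recolour c v (weak v) x); split.
- apply: (weak_extend c_ok cE v4) => // [u uI du wI|y evy yI].
    have [<-|?] := psiE u uI du wI; last by right.
    by left; case: (xA u uI).
  have [dy|dy] := leqP (deg y) 3; first by apply: Or32; exact: max_deg_far.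
  apply: Or31; apply: contraNneq xS => E; apply/imageP; exists y.
    by rewrite !inE evy.
  by rewrite -E addKn.
- by move=> a b eab; exact: (recoloured_uncoloured c_ok cE (weak_nbr v) xav eab).
- by move=> a b /negPf av /negPf bv; rewrite /recolour av bv.
Qed.

(** A single weak vertex without constraint is enough: there [psi] is set to 0, which is no colour,
    so [psi] is never constantly equal to a colour. *)
Lemma max_deg_relaxed u0 X : symmetric X -> u0 \in weak v ->
  (forall c, partial_nsd K e c -> uncoloured_exactly c v (weak v) X ->
     deg u0 = 2 -> other v u0 \notin weak v ->
     exists z, [/\ e (other v u0) z, z != u0 & c (other v u0) z = 0]) ->
  exists c', [/\ partial_nsd K e c',
    forall a b, e a b -> c' a b = 0 -> light a b || X a b &
    forall a b, a != v -> b != v -> light a b || X a b -> c' a b = 0].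
Proof.
move=> X_sym u0I relax.
have [|c c_ok cE] := @weak_start v X X_sym; first by apply/card_gt0P; exists u0.
pose psi u := if u == u0 then 0 else total c (other v u).
have [|u uI du wI|c' [c'_ok c'0 c'E]] := max_deg_extend (psi := psi) c_ok cE.
- by move=> b b0; exists u0 => //; rewrite /psi eqxx neq_ltn b0.
- rewrite /psi; case: eqP => [uu0|_]; last by left.
  by right; rewrite uu0 in du wI *; exact: relax.
exists c'; split=> // a b av bv abX; rewrite c'E //; apply/eqP.
by rewrite -[_ == _]negbK cE; case/orP: abX => ->; rewrite !andbF.
Qed.

(** Every excluded configuration frees [u] from its constraint: a leaf has none, a weak [w] is
    covered by distinctness, and a [z] of degree 2 next to a 3-vertex [w] makes [wz] a second
    uncoloured edge at [w]. If [z] has degree 3, [wz] is not light; it is uncoloured by means of [X]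
    and coloured again before the greedy end. *)
Lemma max_deg_weak u : u \in weak v ->
  [/\ deg u = 2, other v u \notin weak v
    & forall z, e (other v u) z -> z != u -> 4 <= deg z].
Proof.
move=> uI; have [du|[du luw euw wv uniq_w]] := weakP uI.
  have [|c' [c'_ok c'0 _]] := max_deg_relaxed no_rel_sym uI.
    by move=> c _ _; rewrite du.
  by case: (minimal_finish c'_ok) => a b eab /(c'0 a b eab); rewrite orbF.
set w := other v u in luw euw wv uniq_w *.
have evu : e v u := star_nbr (weak_nbr v) uI.
have ewu : e w u by rewrite e_sym.
have vu : v != u by apply: contraTneq evu => ->; rewrite e_irr.
have wI : w \notin weak v.
  apply/negP => wI; have [|c' [c'_ok c'0 _]] := max_deg_relaxed no_rel_sym uI.
    by move=> c _ _ _; rewrite wI.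
  by case: (minimal_finish c'_ok) => a b eab /(c'0 a b eab); rewrite orbF.
split=> // z ewz zu.
have [dw1|dw2] : deg w = 1 \/ 2 <= deg w by have := nbr_gt0 euw; clear; lia.
  by rewrite (deg1_nbr dw1 ewu ewz) eqxx in zu.
have dw : deg w <= 3 by move: luw; rewrite /light_edge du; clear; lia.
have [dwE|dw3] : deg w = 2 \/ deg w = 3 by move: dw dw2; clear; lia.
  by apply: (@deg2_nbr w u z) => //; rewrite ?du // eq_sym.
have wz0 := nbr_gt0 ewz.
have [dz1|] := eqVneq (deg z) 1; first by have := leaf_nbr_deg ewz dz1; rewrite dw3.
have [dz2 _|dz2 dz1] := eqVneq (deg z) 2.
  have [|c' [c'_ok c'0 _]] := max_deg_relaxed no_rel_sym uI.
    move=> c _ cE _ _; exists z; split=> //; apply: light_uncoloured cE _ _ _.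
    by rewrite /light_edge dw3 dz2.
  by case: (minimal_finish c'_ok) => a b eab /(c'0 a b eab); rewrite orbF.
have [dz3|] := eqVneq (deg z) 3.
  2: by move: wz0 dz1 dz2; case: (deg z) => [|[|[|[|n]]]].
pose X : rel V := fun a b => ((a == w) && (b == z)) || ((a == z) && (b == w)).
have X_sym : symmetric X by move=> a b; rewrite /X orbC; congr (_ || _); rewrite andbC.
have zv : z != v by apply: contraTneq v4 => <-; rewrite dz3.
have [|c' [c'_ok c'0 c'X]] := max_deg_relaxed X_sym uI.
  move=> c _ cE _ _; exists z; split=> //; apply/eqP.
  by rewrite -[_ == _]negbK cE /X !eqxx !andbF.
have c'wz : c' w z = 0 by apply: c'X; rewrite // /X !eqxx orbT.
have c'wu : c' w u = 0.
  by apply: c'X; rewrite // ?(light_sym w u) ?luw // eq_sym.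
have wz : w != z by apply: contraTneq ewz => ->; rewrite e_irr.
have ezw : e z w by rewrite e_sym.
have colN a b : e a b -> c' a b = 0 -> #|coloured c' a| <= #|nbr a :\ b|.
  move=> eab cab; apply: subset_leq_card; apply/subsetP => y; rewrite !inE => cy.
  rewrite (pnsd_edge c'_ok cy) andbT.
  by apply: contraNneq cy => ->; rewrite cab.
have cw : #|coloured c' w| <= 1.
  have : #|coloured c' w| <= #|nbr w :\ z :\ u|.
    apply: subset_leq_card; apply/subsetP => y; rewrite !inE => cy.
    rewrite (pnsd_edge c'_ok cy) andbT.
    by apply/andP; split; apply: contraNneq cy => ->; rewrite ?c'wz ?c'wu.
  have := dw3; rewrite /valence (cardsD1 z) (cardsD1 u (_ :\ z)) !inE ewz ewu eq_sym zu.
  clear; lia.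
have Nz : #|nbr z :\ w| = 2 by have := dz3; rewrite /valence (cardsD1 w) inE ezw; clear; lia.
have c'zw : c' z w = 0 by rewrite (pnsd_sym c'_ok).
(* At most 1 + 2 colours occur at [w] and [z], and 1 + 2 neighbours count, so 6 colours are
   forbidden. At [w] only [u] counts: the uncoloured edge [wu] postpones the rest. *)
have [|||a a0 c2_ok] := colour_one_edge (Yu := [set u]) (Yw := nbr z :\ w)
    e_sym e_irr c'_ok ewz c'wz.
- have := colN z w ezw c'zw; move: cw D6; rewrite Nz cards1 /K; clear; lia.
- move=> y ewy yz; rewrite inE => yu; left; exists u.
  by split=> //; rewrite eq_sym.
- by move=> y ezy yw; rewrite !inE yw ezy.
case: (minimal_finish c2_ok) => p q epq c2; have c'pq : c' p q = 0.
  move: c2; rewrite /recolour; case: ifP => [_ a00|_]; first by rewrite a00 in a0.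
  by case: ifP => // _ a00; rewrite a00 in a0.
have /orP[//|/orP[] /andP[/eqP pE /eqP qE]] := c'0 p q epq c'pq; move: c2; rewrite pE qE.
  by rewrite /recolour eqxx inE eqxx /= => a00; rewrite a00 in a0.
rewrite /recolour !inE !eqxx (eq_sym z w) (negPf wz) /= => a00.
by rewrite a00 in a0.
Qed.

Lemma max_deg_other_tstar u : u \in weak v -> deg (other v u) != 2 ->
  tstar (other v u).
Proof.
move=> uI dw2; have [du wI far] := max_deg_weak uI.
have [|[_ luw euw wv uniq_w]] := weakP uI; first by rewrite du.
set w := other v u in dw2 wI far luw euw wv uniq_w *.
have ewu : e w u by rewrite e_sym.
have dw : deg w = 3.
  have := nbr_gt0 euw; move: luw dw2; rewrite /light_edge du.
  have [dw1|] := eqVneq (deg w) 1; last by clear; lia.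
  by have := leaf_nbr_deg euw dw1; rewrite du.
apply/and3P; split; first by rewrite dw.
  apply/cards1P; exists u; apply/setP => y; rewrite !inE.
  have [->|yu] := eqVneq y u; first by rewrite ewu du.
  apply/negP => /andP[ewy /eqP dy]; have := far y ewy yu; by rewrite dy.
have -> : [set y in nbr w | 4 <= deg y] = nbr w :\ u.
  apply/setP => y; rewrite !inE; have [->|yu] := eqVneq y u; first by rewrite du andbF.
  by case ewy: (e w y) => //=; rewrite far.
by move/eqP: dw; rewrite /valence (cardsD1 u) inE ewu.
Qed.

(* In the smaller graph [w1] and [w2] have the same degree 2 and are adjacent,
   so the colours of their remaining edges differ; [deg w1 = deg w2 = 2] keeps
   the new graph sparse. *)
Lemma max_deg_two_paths u1 u2 : u1 \in weak v -> u2 \in weak v -> u1 != u2 ->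
  deg (other v u1) = 2 -> deg (other v u2) = 2 -> False.
Proof.
move=> u1I u2I u12 dw1 dw2.
have fact u : u \in weak v -> deg (other v u) = 2 ->
    let w := other v u in let z := other u w in
    [/\ [/\ e v u, deg u = 2, w != v & w \notin weak v],
        e u w /\ light u w,
        [/\ e w z, z != u, 4 <= deg z & forall y, e w y -> y != u -> y = z] &
        forall y, e u y -> y != v -> y = w].
  move=> uI dw w z; have [du wI far] := max_deg_weak uI.
  have [|[_ luw euw wv uniq_w]] := weakP uI; first by rewrite du.
  have [ewz zu uniq_z] := otherP euw dw.
  have dz : 4 <= deg z by exact: far.
  by have evu : e v u := star_nbr (weak_nbr v) uI.
have [[ev1 du1 w1v w1I] [e1 l1] [ez1 zu1 dz1 uz1] uw1] := fact u1 u1I dw1.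
have [[ev2 du2 w2v w2I] [e2 l2] [ez2 zu2 dz2 uz2] uw2] := fact u2 u2I dw2.
set w1 := other v u1 in dw1 w1v w1I e1 l1 ez1 zu1 dz1 uz1 uw1 *.
set w2 := other v u2 in dw2 w2v w2I e2 l2 ez2 zu2 dz2 uz2 uw2 *.
set z1 := other u1 w1 in ez1 zu1 dz1 uz1.
set z2 := other u2 w2 in ez2 zu2 dz2 uz2.
have ew1 : e w1 u1 by rewrite e_sym.
have ew2 : e w2 u2 by rewrite e_sym.
have small p q : deg p = 2 -> 4 <= deg q -> p != q.
  by move=> dp dq; apply: contraTneq dq => <-; rewrite dp.
have w12 : w1 != w2.
  apply: contraTneq (small _ _ du2 dz1) => w12.
  by rewrite negbK (uz1 u2) // ?w12 // eq_sym.
have ne12 : ~~ e w1 w2.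
  apply/negP => e12; have [w2u1|w2u1] := eqVneq w2 u1.
    by rewrite w2u1 u1I in w2I.
  by have := small _ _ dw2 dz1; rewrite (uz1 w2) // eqxx.
have w1u2 : w1 != u2 by apply: contraNneq w1I => ->.
have w2u1 : w2 != u1 by apply: contraNneq w2I => ->.
have w1u1 : w1 != u1 by apply: contraNneq w1I => ->.
have w2u2 : w2 != u2 by apply: contraNneq w2I => ->.
pose J := [set u1; u2].
pose new a b := ((a == w1) && (b == w2)) || ((a == w2) && (b == w1)).
pose e' : rel V := fun a b => [&& e a b, a \notin J & b \notin J] || new a b.
have new_sym : symmetric new.
  by move=> a b; rewrite /new orbC; congr (_ || _); rewrite andbC.
have e'_sym : symmetric e'.
  by move=> a b; rewrite /e' new_sym e_sym; congr (_ || _); rewrite [X in _ && X]andbC.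
have e'_irr : irreflexive e'.
  move=> a; rewrite /e' e_irr /new /=.
  by case: eqP => [->|_] /=; rewrite ?(negPf w12) ?andbF.
have nw1 : neighbours e' w1 = [set z1; w2].
  apply/setP => y; rewrite !inE /e' /new eqxx (negPf w12) /= orbF.
  rewrite !inE (negPf w1u1) (negPf w1u2) /=.
  have [->|yw2] := eqVneq y w2; first by rewrite !orbT.
  rewrite !orbF; have [->|yz1] := eqVneq y z1.
    by rewrite ez1 (negPf zu1) /= eq_sym small.
  apply/negP => /andP[e1y]; rewrite negb_or => /andP[yu1 _].
  by rewrite (uz1 y) ?eqxx in yz1.
have nw2 : neighbours e' w2 = [set z2; w1].
  apply/setP => y; rewrite !inE /e' /new eqxx (eq_sym w2 w1) (negPf w12) /=.
  rewrite !inE (negPf w2u1) (negPf w2u2) /=.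
  have [->|yw1] := eqVneq y w1; first by rewrite !orbT.
  rewrite !orbF; have [->|yz2] := eqVneq y z2.
    by rewrite ez2 (negPf zu2) /= orbF eq_sym small.
  apply/negP => /andP[e2y]; rewrite negb_or => /andP[_ yu2].
  by rewrite (uz2 y) ?eqxx in yz2.
have z1w2 : z1 != w2 by rewrite eq_sym small.
have z2w1 : z2 != w1 by rewrite eq_sym small.
have e'_out a b : a != w1 -> a != w2 -> e' a b -> e a b.
  by rewrite /e' /new => /negPf-> /negPf->; rewrite orbF => /and3P[].
have e'_deg a : valence e' a <= D.
  have [->|a1] := eqVneq a w1; first by rewrite /valence nw1 cards2 z1w2; move: D6; clear; lia.
  have [->|a2] := eqVneq a w2; first by rewrite /valence nw2 cards2 z2w1; move: D6; clear; lia.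
  apply: leq_trans (degD a); apply: subset_leq_card.
  by apply/subsetP => b; rewrite !inE; exact: e'_out.
have e'E a b : e' a b -> a != w1 \/ b != w2 -> a != w2 \/ b != w1 -> e a b.
  rewrite /e' /new => /orP[/and3P[]//|/orP[] /andP[/eqP-> /eqP->]]; rewrite !eqxx.
    by case.
  by move=> _ [].
have e'_sparse : sparse e'.
  move=> S S0; have [/andP[w1S w2S]|nS] := boolP ((w1 \in S) && (w2 \in S)); last first.
    apply: leq_ltn_trans (e_sparse S0); apply: subset_leq_card.
    apply/subsetP => [[a b]]; rewrite !inE /= => /and3P[aS bS]; rewrite aS bS.
    move=> /e'E; apply.
      have [aw1|] := eqVneq a w1; [right | by left].
      by apply: contraNneq nS => <-; rewrite -aw1 aS bS.
    have [aw2|] := eqVneq a w2; [right | by left].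
    by apply: contraNneq nS => <-; rewrite -aw2 aS bS.
  (* The arcs meeting [w1] or [w2] belong to the new edge or lead to [z1] and [z2]: at most 6 = 3 *
     2, just what two vertices allow. Strictness comes from [S1] in the old graph; if [S1] is empty,
     only the two arcs of the new edge remain. *)
  pose S1 := S :\ w1 :\ w2.
  have cS : #|S| = #|S1| + 2.
    rewrite (cardsD1 w1) w1S (cardsD1 w2 (S :\ w1)) !inE w2S eq_sym w12 /=.
    by rewrite -/S1; clear; lia.
  pose s := if z1 \in S1 then [:: (w1, z1); (z1, w1)] else [::].
  pose s' := if z2 \in S1 then [:: (w2, z2); (z2, w2)] else [::].
  pose ext := [:: (w1, w2); (w2, w1)] ++ s ++ s'.
  have inS1 a : a \in S -> a != w1 -> a != w2 -> a \in S1.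
    by move=> aS a1 a2; rewrite !inE a1 a2.
  have z1w1 : z1 != w1 by apply: contraTneq ez1 => ->; rewrite e_irr.
  have z2w2 : z2 != w2 by apply: contraTneq ez2 => ->; rewrite e_irr.
  have half a b : a \in S -> b \in S -> e' a b ->
      (a == w1) || (a == w2) -> ((a, b) \in ext) && ((b, a) \in ext).
    move=> aS bS e'ab /orP[] /eqP aE; rewrite {a}aE in aS e'ab *.
      have : b \in neighbours e' w1 by rewrite inE.
      rewrite nw1 => /set2P[]bE; rewrite {b}bE in bS e'ab *; last first.
        by rewrite /ext !inE !eqxx !orbT.
      by rewrite /ext /s inS1 // !mem_cat !inE !eqxx !orbT.
    have : b \in neighbours e' w2 by rewrite inE.
    rewrite nw2 => /set2P[]bE; rewrite {b}bE in bS e'ab *; last first.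
      by rewrite /ext !inE !eqxx !orbT.
    by rewrite /ext /s' inS1 // !mem_cat !inE !eqxx !orbT.
  have sub : arcs_in e' S \subset arcs_in e S1 :|: [set p | p \in ext].
    apply/subsetP => [[a b]]; rewrite in_setU [in X in _ -> X]inE.
    rewrite [X in _ -> _ || X]inE inE /= => /and3P[aS bS e'ab].
    have [Ha|] := boolP ((a == w1) || (a == w2)).
      by have /andP[->] := half a b aS bS e'ab Ha; rewrite orbT.
    have e'ba : e' b a by rewrite e'_sym.
    have [Hb _|] := boolP ((b == w1) || (b == w2)).
      by have /andP[_ ->] := half b a bS aS e'ba Hb; rewrite orbT.
    rewrite !negb_or => /andP[b1 b2] /andP[a1 a2].
    by rewrite !inS1 // (e'_out a b).
  have ext_le : #|[set p | p \in ext]| <= size ext by rewrite cardsE card_size.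
  have [S1E|S1N] := eqVneq S1 set0.
    have s0 : size ext = 2 by rewrite /ext /s /s' S1E !inE.
    have a0 : arcs_in e S1 = set0.
      by apply/setP => p; rewrite S1E !inE.
    have := subset_leq_card sub; rewrite a0 set0U cS.
    move=> le; apply: leq_ltn_trans (leq_trans le ext_le) _.
    by rewrite s0; clear; lia.
  have s6 : size ext <= 6 by rewrite /ext /s /s' !size_cat /=; do 2!case: ifP.
  apply: leq_ltn_trans (leq_trans (subset_leq_card sub) (leq_card_setU _ _)) _.
  rewrite cS mulnDr -addSn leq_add //; first exact: e_sparse.
  exact: leq_trans ext_le s6.
have e'_fewer : #|arcs e'| < #|arcs e|.
  have vJ : v \notin J.
    by rewrite !inE negb_or; apply/andP; split;
       [apply: contraTneq ev1 | apply: contraTneq ev2] => ->; rewrite e_irr.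
  (* Three deleted arcs already outnumber the two arcs of the new edge. *)
  pose P := [set (v, u1); (u1, v); (v, u2)].
  have u1v : u1 != v by apply: contraNneq vJ => <-; rewrite !inE eqxx.
  have cP : #|P| = 3.
    rewrite /P setUC cardsU1 !inE cards2 !xpair_eqE !eqxx /= (eq_sym u2 u1) (negPf u12).
    by rewrite (eq_sym v u1) (negPf u1v).
  have PA : P \subset arcs e.
    by apply/subsetP => p; rewrite !inE => /orP[/orP[]|] /eqP-> //=; rewrite e_sym.
  have : arcs e' \subset (arcs e :\: P) :|: [set (w1, w2); (w2, w1)].
    apply/subsetP => [[a b]]; rewrite !inE /= => /orP[/and3P[eab aJ bJ]|]; last first.
      by case/orP => /andP[/eqP-> /eqP->]; rewrite !eqxx !orbT.
    rewrite eab andbT; apply/orP; left; rewrite !xpair_eqE !negb_or.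
    move: aJ bJ; rewrite !inE !negb_or => /andP[au1 au2] /andP[bu1 bu2].
    by rewrite (negPf bu1) (negPf au1) (negPf bu2) !andbF.
  move=> /subset_leq_card/leq_trans/(_ (leq_card_setU _ _)).
  rewrite cards2 !xpair_eqE (negPf w12) /= cardsD (setIidPr PA) cP.
  have arith m n : 3 <= n -> m <= n - 3 + 2 -> m < n by clear; lia.
  by apply: arith; rewrite -cP subset_leq_card.
have [c' [c'_ok full]] := min_smaller e_min e'_sym e'_irr e'_deg e'_sparse e'_fewer.
pose U : rel V := fun a b => star v (weak v) a b || light a b.
have U_sym : symmetric U by move=> a b; rewrite /U star_sym light_sym.
have JU a y : y \in J -> e a y -> U a y.
  have vI := star_centre (weak_nbr v).
  move=> /set2P[]-> eay; rewrite U_sym; have [->|av] := eqVneq a v.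
  - by rewrite U_sym /U starE // u1I.
  - by rewrite (uw1 a) // ?(e_sym u1) // /U l1 orbT.
  - by rewrite U_sym /U starE // u2I.
  - by rewrite (uw2 a) // ?(e_sym u2) // /U l2 orbT.
have J2 a b : a \in J -> exists y, [/\ e a y, y != b & U a y].
  move=> aJ; suff [y [eay yb]] : exists y, e a y /\ y != b.
    by exists y; split=> //; rewrite U_sym JU // e_sym.
  have [bv|bv] := eqVneq b v; last first.
    by exists v; rewrite (e_sym a) eq_sym bv; case/set2P: aJ => ->.
  by case/set2P: aJ => ->; [exists w1 | exists w2]; rewrite bv.
have sub a b : e a b -> ~~ U a b -> e' a b.
  move=> eab NU; rewrite /e' eab /=; apply/orP; left; apply/andP; split.
    by apply: contra NU => aJ; rewrite U_sym JU // e_sym.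
  by apply: contra NU => bJ; exact: JU.
have c_ok : partial_nsd K e (fun a b => if e a b && ~~ U a b then c' a b else 0).
  apply: (restrict_colouring e_sym U_sym c'_ok full sub) => a b eab da db.
  have [aJ|aJ] := boolP (a \in J); first by apply: Or31; exact: J2.
  have [bJ|bJ] := boolP (b \in J); first by apply: Or32; exact: J2.
  (* A vertex with a neighbour in [J] sees an uncoloured edge. This includes [w1] and [w2], so all
     other vertices keep their neighbourhoods. *)
  have clean p q : p \notin J -> q \notin J ->
      (exists y, [/\ e p y, y != q & U p y]) \/
      [/\ p != w1, p != w2 & neighbours e' p = nbr p].
    move=> pJ qJ; have [/existsP[y /andP[yJ epy]]|] := boolP [exists y in J, e p y].
      left; exists y; split=> //; last exact: JU.
      by apply: contraNneq qJ => <-.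
    rewrite negb_exists => /forallP noJ; right.
    have p1 : p != w1.
      by apply/eqP => pE; have := noJ u1; rewrite pE ew1 !inE eqxx.
    have p2 : p != w2.
      by apply/eqP => pE; have := noJ u2; rewrite pE ew2 !inE eqxx orbT.
    split=> //; apply/setP => y; rewrite !inE /e' /new (negPf p1) (negPf p2) orbF pJ.
    by case epy: (e p y) => //=; have := noJ y; rewrite epy andbT.
  have [?|[a1 a2 na]] := clean a b aJ bJ; first exact: Or31.
  have [?|[b1 b2 nb]] := clean b a bJ aJ; first exact: Or32.
  by apply: Or33; split=> //; rewrite /e' eab aJ bJ.
set c := fun a b => _ in c_ok.
have cE : uncoloured_exactly c v (weak v) no_rel.
  move=> a b; rewrite /c andbT -negb_or -/(U a b); case: ifP => // /andP[eab NU].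
  by rewrite full // sub.
have tot w u z : w != v -> w \notin weak v -> light u w -> e w z -> z != u ->
    deg w = 2 -> 4 <= deg z -> (forall y, e w y -> y != u -> y = z) ->
    total c w = c' w z.
  move=> wv wI luw ewz zu dw dz uz; rewrite /total (bigD1 z) //= big1 ?addn0.
    rewrite /c ewz /U /star (negPf wv) (negPf wI) andbF /=.
    by rewrite /light_edge dw leqNgt (leq_ltn_trans _ (_ : 5 < 2 + deg z)).
  move=> y yz; rewrite /c; case: ifP => // /andP[ewy]; rewrite /U negb_or => /andP[_].
  have [->|yu] := eqVneq y u; first by rewrite light_sym luw.
  by rewrite (uz y) ?eqxx in yz.
have psi12 : total c w1 != total c w2.
  rewrite (tot w1 u1 z1) // (tot w2 u2 z2) //.
  have e'12 : e' w1 w2 by rewrite /e' /new !eqxx orbT.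
  have split_total w z w' : neighbours e' w = [set z; w'] -> z != w' ->
      total c' w = c' w w' + c' w z.
    move=> nE zw'; rewrite (total_split (pnsd_edge c'_ok) w w') nE.
    have -> : [set z; w'] :\ w' = [set z].
      by rewrite setUC setU1K // inE eq_sym.
    by rewrite big_set1.
  have oc p q : others_coloured e' c' p q by move=> y e'py _; exact: full.
  have := pnsd_sum c'_ok e'12; rewrite /valence nw1 nw2 !cards2 z1w2 z2w1.
  move=> /(_ isT isT (oc _ _) (oc _ _)).
  rewrite (split_total w1 z1 w2) // (split_total w2 z2 w1) //.
  by rewrite (pnsd_sym c'_ok w2 w1) eqn_add2l.
have [b b0|u uI du wI|c2 [c2_ok c20 _]] :=
    max_deg_extend (psi := fun u => total c (other v u)) c_ok cE.
- have [E|] := eqVneq (total c w1) b; last by exists u1.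
  by exists u2 => //; rewrite -E eq_sym.
- by left.
by case: (minimal_finish c2_ok) => a b eab /(c20 a b eab); rewrite orbF.
Qed.

End MaxDegree.

(** * Vertices of degree 4 and 5 *)

Definition mate v u :=
  if deg u == 2 then other v u
  else odflt u [pick y | e u y && (deg y == 2)].

Lemma tstar_nbrs v u : 4 <= deg v -> e v u -> tstar u ->
  [/\ e u (mate v u), deg (mate v u) = 2 &
     exists z, [/\ z != v, 4 <= deg z &
       forall y, e u y -> [\/ y = v, y = mate v u | y = z]]].
Proof.
move=> v4 evu /and3P[/eqP du /cards1P[u2 E2] H4].
have [eu2 du2] : e u u2 /\ deg u2 = 2.
  by have := set11 u2; rewrite -E2 !inE => /andP[? /eqP].
have mE : mate v u = u2.
  rewrite /mate du /=; case: pickP => [y /= Hy|/(_ u2)]; last by rewrite eu2 du2.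
  by apply/set1P; rewrite -E2 !inE.
have uv : v \in [set y in nbr u | 4 <= deg y] by rewrite !inE e_sym evu.
have /cards1P[z Ez] : #|[set y in nbr u | 4 <= deg y] :\ v| == 1.
  by move: H4; rewrite (cardsD1 v) uv.
have [zv dz] : z != v /\ 4 <= deg z.
  by have := set11 z; rewrite -Ez !inE => /andP[? /andP[_ ?]].
rewrite mE; split=> //; exists z; split=> // y euy.
have cover : [set y in nbr u | deg y == 2] :|: [set y in nbr u | 4 <= deg y] = nbr u.
  apply/eqP; rewrite eqEcard; apply/andP; split.
    by apply/subsetP => a; rewrite !inE => /orP[] /andP[].
  rewrite cardsU (eqP H4) E2 cards1 -/(deg u) du.
  suff -> : [set u2] :&: [set y in nbr u | 4 <= deg y] = set0 by rewrite cards0.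
  by apply/setP => a; rewrite !inE; case: eqP => //= ->; rewrite du2 andbF.
have : y \in nbr u by rewrite inE.
rewrite -cover E2 in_setU => /orP[/set1P|y4]; first exact: Or32.
have [|yv] := eqVneq y v; first exact: Or31.
by apply: Or33; apply/set1P; rewrite -Ez in_setD1 yv.
Qed.

(** Such a neighbour [u] forbids at most two further colours: it keeps at most one coloured edge,
    and away from [v] only the edge to its mate can have its condition decided. For [tstar u] the
    third edge is postponed by the light edge to the mate. *)
Definition pliant v := bad2 v :|: good2 v :|: tstars v.

Lemma pliant_nbr v : pliant v \subset nbr v.
Proof. by apply/subsetP => u; rewrite !inE -orbA => /or3P[] /andP[]. Qed.

Lemma pliantP v u : u \in pliant v ->
  (deg u = 2 /\ mate v u = other v u) \/ tstar u.
Proof.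
rewrite !inE -orbA => /or3P[] /andP[evu]; last by right.
  by case/andP=> /eqP du _; left; rewrite /mate du.
by case/andP=> /eqP du _; left; rewrite /mate du.
Qed.

Section Pliant.
Variables (c : V -> V -> nat) (v : V) (I : {set V}).
Hypothesis c_ok : partial_nsd K e c.
Hypothesis cE : uncoloured_exactly c v I no_rel.
Hypothesis I_nbr : I \subset nbr v.
Hypothesis v4 : 4 <= deg v.

Lemma pliant_safe u : u \in I -> u \in pliant v ->
  total c u <= K /\
  forall a, 0 < a -> a != total c u -> a != total c (mate v u) - total c u ->
  (forall y, c u y != a) /\
  (forall y, e u y -> y != v -> y \notin I ->
     [\/ total c u + a != total c y,
         exists z, [/\ e u z, z != y, z != v & c u z = 0] |
         exists z, [/\ e y z, z != u & c y z = 0]]).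
Proof.
move=> uI uP; have evu := star_nbr I_nbr uI.
have cuv : c u v = 0 by rewrite (pnsd_sym c_ok) (star_uncoloured cE I_nbr uI).
have sub_ne a y : a != total c y - total c u -> total c u + a != total c y.
  by apply: contraNneq => <-; rewrite addKn.
have cN y : ~~ e u y -> c u y = 0.
  by move=> neuy; apply/eqP/negPn; apply: contra neuy => /(pnsd_edge c_ok).
suff [w [tE row out]] : exists w, [/\ total c u = c u w,
    forall y, y != w -> c u y = 0 &
    forall a, 0 < a -> a != total c (mate v u) - total c u ->
      forall y, e u y -> y != v -> y \notin I ->
     [\/ total c u + a != total c y,
         exists z, [/\ e u z, z != y, z != v & c u z = 0] |
         exists z, [/\ e y z, z != u & c y z = 0]]].
  split=> [|a a0 at1 at2]; first by rewrite tE (pnsd_le c_ok).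
  split; last exact: out.
  move=> y; have [->|/row->] := eqVneq y w; first by rewrite -tE eq_sym.
  by rewrite eq_sym -lt0n.
have tot w : (forall y, y != w -> c u y = 0) -> total c u = c u w.
  by move=> row; rewrite /total (bigD1 w) //= big1 ?addn0.
have [[du mE]|tu] := pliantP uP.
  have [euw wv uniq_w] := otherP evu du; exists (other v u).
  have row y : y != other v u -> c u y = 0.
    move=> yw; have [->//|yv] := eqVneq y v.
    by apply: cN; apply: contraNN yw => euy; rewrite (uniq_w y).
  rewrite mE; split=> // [|a a0 am y euy yv _]; first exact: tot.
  by apply: Or31; apply: sub_ne; rewrite (uniq_w y).
have [eum dm [z [zv dz nbrs]]] := tstar_nbrs v4 evu tu.
have du : deg u = 3 by case/and3P: tu => /eqP.
have cum : c u (mate v u) = 0.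
  by apply: light_uncoloured cE _ _ _; rewrite /light_edge du dm.
have mv : mate v u != v by apply: contraTneq v4 => <-; rewrite dm.
have mz : mate v u != z by apply: contraTneq dz => <-; rewrite dm.
have row y : y != z -> c u y = 0.
  move=> yz; have [euy|] := boolP (e u y); last exact: cN.
  by have [->|->|yE] := nbrs y euy; rewrite // yE eqxx in yz.
exists z; split=> //; first exact: tot.
move=> a a0 am y euy yv yI; have [yE|yE|->] := nbrs y euy.
- by rewrite yE eqxx in yv.
- by apply: Or31; apply: sub_ne; rewrite yE.
- by apply: Or32; exists (mate v u).
Qed.

Lemma pliant_undecided u : u \in I -> u \in bad2 v :|: tstars v ->
  exists z, [/\ e u z, z != v & c u z = 0].
Proof.
move=> uI; rewrite !inE => /orP[] /andP[evu].
  case/andP=> /eqP du dw; have [euw wv _] := otherP evu du.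
  exists (other v u); split=> //.
  by apply: light_uncoloured cE _ _ _; rewrite /light_edge du.
move=> tu; have [eum dm _] := tstar_nbrs v4 evu tu; exists (mate v u).
have du : deg u = 3 by case/and3P: tu => /eqP.
split=> //; first by apply: contraTneq v4 => <-; rewrite dm.
by apply: light_uncoloured cE _ _ _; rewrite /light_edge du dm.
Qed.

Definition pliant_list u :=
  rem (total c (mate v u) - total c u) (rem (total c u) (available c v I)).

Lemma pliant_list_uniq u : uniq (pliant_list u).
Proof. by do 2!apply: rem_uniq; exact: available_uniq. Qed.

Lemma pliant_list_size u : K + #|I| <= size (pliant_list u) + deg v + 2.
Proof.
have := size_available c I_nbr; rewrite -/K => sz.
have [small|large] := leqP (K + #|I|) (deg v + 2).
  by rewrite -addnA; apply: leq_trans small (leq_addl _ _).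
have le : K + #|I| - deg v - 2 <= size (pliant_list u).
  by do 2!apply: size_rem_ge; move: sz large; clear; lia.
by move: le; clear; lia.
Qed.

Lemma pliant_listP u a : a \in pliant_list u ->
  [/\ a \in available c v I, a != total c u
    & a != total c (mate v u) - total c u].
Proof.
have uA := available_uniq c v I.
by do 2!rewrite mem_rem_uniq ?rem_uniq // inE /=; case/and3P.
Qed.

(** Only good 2-neighbours in [I] have their sums compared with that of [v]; the other members of
    [I] keep an uncoloured light edge. *)
Lemma pliant_finish x : I \subset pliant v ->
  (forall u y, u \in I -> y \in I -> ~~ e u y) ->
  (forall u, u \in I -> x u \in pliant_list u) -> {in I &, injective x} ->
  (forall y, e v y -> y \notin I ->
     total c v + \sum_(u in I) x u != total c y) ->
  (forall u, u \in I -> u \in good2 v ->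
     total c v + \sum_(u in I) x u != total c u + x u) -> False.
Proof.
move=> I_pl noadj xL x_inj c_out c_in.
have x_av u : u \in I -> x u \in available c v I by move=> /xL/pliant_listP[].
have x_pos u : u \in I -> 0 < x u.
  by move=> /x_av/(availableP c_ok cE I_nbr)[/andP[]].
have safe u (uI : u \in I) := proj2 (pliant_safe uI (subsetP I_pl u uI)).
apply: (minimal_finish (c := recolour c v I x)).
  apply: (star_extend c_ok cE I_nbr) => //.
  - move=> u y uI; have [_ n1 n2] := pliant_listP (xL u uI).
    by have [] := safe u uI (x u) (x_pos u uI) n1 n2.
  - by move=> y evy yI; apply: Or31; exact: c_out.
  - move=> u uI; have [uG|uG] := boolP (u \in good2 v); first by apply: Or33; exact: c_in.
    apply: Or32; apply: pliant_undecided => //.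
    by have := subsetP I_pl u uI; rewrite /pliant setUAC in_setU (negPf uG) orbF.
  - move=> u y uI; have [_ n1 n2] := pliant_listP (xL u uI).
    by have [_] := safe u uI (x u) (x_pos u uI) n1 n2; apply.
  - by move=> u y uI yI; rewrite (negPf (noadj u y uI yI)).
by move=> a b eab /(recoloured_uncoloured c_ok cE I_nbr x_av eab); rewrite orbF.
Qed.

End Pliant.

Lemma good2_nbr v u y : u \in good2 v -> e u y -> y != v -> 4 <= deg y.
Proof.
rewrite !inE => /and3P[evu /eqP du dw] euy yv.
by have [_ _ uniq_w] := otherP evu du; rewrite (uniq_w y).
Qed.

Lemma good2_nonadj v u y : u \in good2 v -> y \in nbr v -> deg y <= 3 ->
  ~~ e u y.
Proof.
move=> uG; rewrite inE => evy dy; apply/negP => euy.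
have yv : y != v by apply: contraTneq evy => ->; rewrite e_irr.
by have := good2_nbr uG euy yv; rewrite leqNgt ltnS dy.
Qed.

Lemma tstars_nonadj v u y : 4 <= deg v -> u \in tstars v -> y \in tstars v -> ~~ e u y.
Proof.
rewrite !inE => v4 /andP[evu tu] /andP[evy ty]; apply/negP => euy.
have [_ dm [z [_ dz nbrs]]] := tstar_nbrs v4 evu tu.
have dy : deg y = 3 by case/and3P: ty => /eqP.
have [yE|yE|yE] := nbrs y euy; first by rewrite yE e_irr in evy.
  by rewrite -yE dy in dm.
by rewrite -yE dy in dz.
Qed.

Lemma pliant_deg v u : u \in pliant v -> deg u <= 3.
Proof. by case/pliantP=> [[->]|/and3P[/eqP->]]. Qed.

Lemma pliant_start v (I : {set V}) : I \subset pliant v -> 1 < #|I| ->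
  exists2 c, partial_nsd K e c & uncoloured_exactly c v I no_rel.
Proof.
move=> I_pl I2; apply: star_start => //; first exact: subset_trans I_pl (pliant_nbr v).
  by rewrite -card_gt0 ltnW.
move=> u uI; apply: Or32; have /card_gt0P[w] : 0 < #|I :\ u|.
  by move: I2; rewrite (cardsD1 u) uI.
by rewrite !inE => /andP[wu wI]; exists w.
Qed.

Lemma good_tstar_nonadj v u y : 4 <= deg v -> u \in good2 v :|: tstars v ->
  y \in good2 v :|: tstars v -> ~~ e u y.
Proof.
have gd a : a \in good2 v -> a \in nbr v /\ deg a <= 3.
  by rewrite !inE => /and3P[-> /eqP->].
have td a : a \in tstars v -> a \in nbr v /\ deg a <= 3.
  by rewrite !inE => /andP[-> /and3P[/eqP->]].
move=> v4; rewrite !in_setU => /orP[uG|uT] /orP[yG|yT].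
- by have [yN y3] := gd y yG; exact: good2_nonadj uG yN y3.
- by have [yN y3] := td y yT; exact: good2_nonadj uG yN y3.
- by have [uN u3] := td u uT; rewrite e_sym; exact: good2_nonadj yG uN u3.
- exact: tstars_nonadj uT yT.
Qed.

(** All edges at [v] are deleted, so the lists keep [K - 2] colours and [large_choice] makes the sum
    at [v] exceed [K + x u]. A good 2-neighbour [u] has one other edge, so its sum is at most
    [K + x u]. *)
Lemma not_all_good v : 4 <= deg v <= 5 -> nbr v \subset good2 v :|: tstars v ->
  False.
Proof.
move=> /andP[v4 v5] all_good.
have I_pl : nbr v \subset pliant v.
  by apply: subset_trans all_good _; rewrite /pliant -setUA subsetUr.
have [|c c_ok cE] := pliant_start I_pl; first by move: v4; rewrite /valence; clear; lia.
have [|u uI|x [x_inj xL x_big]] := @large_choice V (nbr v) (pliant_list c v (nbr v)) K K7.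
- by rewrite v4.
- split; first exact: pliant_list_uniq.
    have := pliant_list_size c (subxx (nbr v)) u.
    by rewrite -/(deg v) addnAC leq_add2r leq_subLR addnC.
  by move=> a /pliant_listP[/(availableP c_ok cE (subxx _))[/andP[]]].
apply: (pliant_finish (x := x) c_ok cE (subxx _) v4) => //.
- by move=> u y uI yI; apply: (good_tstar_nonadj v4); exact: subsetP all_good _ _.
- by move=> y evy; rewrite inE evy.
move=> u uI uG; rewrite neq_ltn; apply/orP; right.
have [tK _] := pliant_safe c_ok cE (subxx _) v4 uI (subsetP I_pl u uI).
apply: leq_trans (leq_addl _ _); apply: leq_ltn_trans (x_big u uI).
by rewrite leq_add2r.
Qed.

Lemma pair_avoiding_seq (L1 L2 r : seq nat) : uniq L1 -> uniq L2 ->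
  1 < size L1 -> 2 < size L2 -> size r <= 2 ->
  exists x1 x2, [/\ x1 \in L1, x2 \in L2, x1 != x2 & x1 + x2 \notin r].
Proof.
move=> u1 u2 s1 s2 sr.
(* If [r] is shorter than 2, the default 0 merely excludes one more sum. *)
have [x1 [x2 [x1L x2L x12 n1 n2]]] := pair_avoiding (nth 0 r 0) (nth 0 r 1) u1 u2 s1 s2.
exists x1, x2; split=> //; apply/negP => /(nthP 0)[[|[|i]] ir E].
- by rewrite E eqxx in n1.
- by rewrite E eqxx in n2.
- by move: (leq_trans ir sr).
Qed.

(** The edges to [u] and [g] are deleted, and the condition on [uv] is postponed. In the condition
    on [gv] the new colour of [gv] cancels, so it forbids one colour at [u]. Lists of at least 2 and
    3 colours remain, against the sums of the two other neighbours. *)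
Lemma no_mixed_pair v u g : deg v = 4 -> u \in bad2 v :|: tstars v ->
  g \in good2 v -> False.
Proof.
move=> dv uB gG.
have v4 : 4 <= deg v by rewrite dv.
have ug : u != g.
  apply: contraTneq uB => ->; move: gG; rewrite !inE => /and3P[-> /eqP dg dw].
  by rewrite dg leqNgt dw /tstar dg.
pose I := [set u; g].
have I_pl : I \subset pliant v.
  apply/subsetP => y /set2P[]->; rewrite /pliant.
    by rewrite setUAC in_setU uB.
  by rewrite 2!in_setU gG orbT.
have I_nbr := subset_trans I_pl (pliant_nbr v).
have cI : #|I| = 2 by rewrite cards2 ug.
have [|c c_ok cE] := pliant_start I_pl; first by rewrite cI.
have sz y : 3 <= size (pliant_list c v I y).
  by have := pliant_list_size c I_nbr y; move: K7; rewrite dv cI; clear; lia.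
have [|||||xu [xg [xuL xgL xug xr]]] := @pair_avoiding_seq
    (rem (total c g - total c v) (pliant_list c v I u)) (pliant_list c v I g)
    [seq total c y - total c v | y in nbr v :\: I].
- by rewrite rem_uniq ?pliant_list_uniq.
- exact: pliant_list_uniq.
- exact: size_rem_ge.
- exact: sz.
- rewrite size_image; have := cardsID I (nbr v).
  by rewrite (setIidPr I_nbr) cI -/(deg v) dv; clear; lia.
move: xuL; rewrite mem_rem_uniq ?pliant_list_uniq // inE => /andP[xug' xuL].
pose x y := if y == u then xu else xg.
have xE : ((x u = xu) * (x g = xg))%type by rewrite /x eqxx eq_sym (negPf ug).
have sumE : \sum_(y in I) x y = xu + xg.
  by rewrite /I big_setU1 ?inE //= big_set1 !xE.
have ud : deg u <= 3 by apply: pliant_deg; apply: (subsetP I_pl); rewrite !inE eqxx.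
have uN : u \in nbr v by apply: (subsetP I_nbr); rewrite !inE eqxx.
have neug := good2_nonadj gG uN ud.
apply: (pliant_finish (x := x) c_ok cE I_nbr v4) => //.
- move=> a b /set2P[]-> /set2P[]->; rewrite ?e_irr // e_sym //.
- by move=> y /set2P[]->; rewrite !xE.
- move=> a b /set2P[]-> /set2P[]->; rewrite !xE // => E; first by rewrite E eqxx in xug.
  by rewrite E eqxx in xug.
- move=> y evy yI; rewrite sumE; apply: contraNneq xr => E; apply/imageP; exists y.
    by rewrite inE yI inE.
  by rewrite -E addKn.
move=> y /set2P[]-> yG; rewrite sumE xE.
  have := good2_nbr yG; move: uB; rewrite !inE => /orP[] /andP[evu].
    move=> /andP[/eqP du dw]; have [euw wv _] := otherP evu du.
    by move=> /(_ _ euw wv); rewrite leqNgt ltnS dw.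
  move=> tu; have [eum dm _] := tstar_nbrs v4 evu tu.
  have mv : mate v u != v by apply: contraTneq v4 => <-; rewrite dm.
  by move=> /(_ _ eum mv); rewrite dm.
rewrite addnA eqn_add2r; apply: contraNneq xug' => E.
by rewrite -E addKn.
Qed.

(** Two of the three good neighbours are handled by size: the other edges at [v] sum to more than
    [K], while a 2-vertex has only one other edge. The third one and the remaining neighbour [p] are
    the two exclusions of [triple_avoiding]. *)
Lemma no_three_good v : deg v = 4 -> #|good2 v| <= 2.
Proof.
move=> dv; rewrite leqNgt; apply/negP => g3.
have v4 : 4 <= deg v by rewrite dv.
have /card_gt0P[g1 g1G] : 0 < #|good2 v| by move: g3; clear; lia.
have c1 : 1 < #|good2 v :\ g1| by move: g3; rewrite (cardsD1 g1) g1G.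
have /card_gt0P[g2] : 0 < #|good2 v :\ g1| by rewrite ltnW.
move=> g2G'; have c2 : 0 < #|good2 v :\ g1 :\ g2|.
  by move: c1; rewrite (cardsD1 g2) g2G'.
have /card_gt0P[h] := c2.
move: g2G'; rewrite !in_setD1 => /andP[g21 g2G] /and3P[g32 g31 g3G].
pose I := g1 |: [set g2; h].
have I_good : I \subset good2 v.
  by apply/subsetP => y; rewrite in_setU1 => /orP[/eqP->//|/set2P[]->].
have cI : #|I| = 3.
  by rewrite /I cardsU1 cards2 !inE negb_or (eq_sym g1) g21 (eq_sym g1) g31 eq_sym g32.
have I_pl : I \subset pliant v.
  by apply: subset_trans I_good _; rewrite /pliant setUAC subsetUr.
have I_nbr := subset_trans I_pl (pliant_nbr v).
have [|c c_ok cE] := pliant_start I_pl; first by rewrite cI.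
have /cards1P[p pE] : #|nbr v :\: I| == 1.
  have := cardsID I (nbr v); rewrite (setIidPr I_nbr) cI -/(deg v) dv.
  by move=> /eqP; rewrite -[4]/(3 + 1) eqn_add2l.
have [pI evp] : p \notin I /\ e v p.
  by have := set11 p; rewrite -pE !inE => /andP[].
have out y : e v y -> y \notin I -> y = p.
  by move=> evy yI; apply/set1P; rewrite -pE inE yI inE.
have vI := star_centre I_nbr.
(* [vp] is coloured, since it could be light only if [p] were a leaf, and a leaf needs a neighbour
   of degree at least 5. *)
have cp : 0 < c v p.
  rewrite lt0n cE evp starE // pI andbT /= /light_edge dv.
  have := nbr_gt0 evp; have [dp|] := eqVneq (deg p) 1; last by clear; lia.
  by have := leaf_nbr_deg evp dp; rewrite dv.
have tv : total c v = c v p.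
  rewrite /total (bigD1 p) //= big1 ?addn0 // => y yp.
  have [evy|nevy] := boolP (e v y); last first.
    by apply/eqP/negPn; apply: contra nevy => /(pnsd_edge c_ok).
  have [yI|/(out y evy) yE] := boolP (y \in I); first exact: star_uncoloured cE I_nbr _ yI.
  by rewrite yE eqxx in yp.
have g1I : g1 \in I by rewrite !inE eqxx.
have g2I : g2 \in I by rewrite !inE eqxx orbT.
have hI : h \in I by rewrite !inE eqxx !orbT.
have tK u : u \in I -> total c u <= K.
  by move=> uI; have [] := pliant_safe c_ok cE I_nbr v4 uI (subsetP I_pl u uI).
have listP u : [/\ uniq (pliant_list c v I u), K - 3 <= size (pliant_list c v I u)
     & forall a, a \in pliant_list c v I u -> 0 < a <= K /\ a != c v p].
  split; first exact: pliant_list_uniq.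
    by have := pliant_list_size c I_nbr u; rewrite dv cI; clear; lia.
  move=> a /pliant_listP[/(availableP c_ok cE I_nbr)[? na] _ _].
  by split=> //; rewrite eq_sym.
have [|x1 [x2 [x3 [[x1L x2L x3L] [[x12 x13 x23 far2 far3] [ng nb]]]]]] :=
  @triple_avoiding K (c v p) (pliant_list c v I g1) (pliant_list c v I g2)
    (pliant_list c v I h) (total c g1) (total c p - total c v) K7 cp (tK _ g1I).
  by move=> L; rewrite !inE => /or3P[] /eqP->.
pose x y := if y == g1 then x1 else if y == g2 then x2 else x3.
have [xE1 xE2 xE3] : [/\ x g1 = x1, x g2 = x2 & x h = x3].
  by rewrite /x !eqxx (negPf g21) (negPf g31) (negPf g32).
have sumE : \sum_(y in I) x y = x1 + (x2 + x3).
  rewrite /I big_setU1 ?big_setU1 ?big_set1 ?inE ?xE1 ?xE2 ?xE3 //.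
    by rewrite eq_sym.
  by rewrite negb_or ![g1 == _]eq_sym g21 g31.
have IP y : y \in I -> [\/ y = g1, y = g2 | y = h].
  by rewrite !inE => /or3P[] /eqP->; [exact: Or31 | exact: Or32 | exact: Or33].
apply: (pliant_finish (x := x) c_ok cE I_nbr v4) => //.
- move=> a b aI bI; apply: (good_tstar_nonadj v4); rewrite in_setU.
    by rewrite (subsetP I_good).
  by rewrite (subsetP I_good).
- by move=> y /IP[]->; rewrite ?xE1 ?xE2 ?xE3.
- move=> a b /IP[]-> /IP[]->; rewrite ?xE1 ?xE2 ?xE3 // => E; exfalso;
    by move: x12 x13 x23; rewrite E eqxx ?andbF.
- move=> y evy yI; rewrite (out y evy yI) sumE; apply: contraNneq nb => E.
  by rewrite -E addKn addnA.
move=> y /IP[]-> _; rewrite sumE tv ?xE1 ?xE2 ?xE3.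
- by move: ng; clear; lia.
- by move: far3 (tK _ g2I); clear; lia.
- by move: far2 (tK _ hI); clear; lia.
Qed.

(** * Discharging *)

(* Charges in units of 1/4. *)
Definition give v u :=
  if ~~ e v u then 0
  else if 4 <= deg v then
    if deg u == 2 then
      (if (4 <= deg (other v u)) || tstar (other v u) then 2 else 4)
    else (tstar u : nat)
  else if tstar v && (deg u == 2) then 2 else 0.

Definition gives v := \sum_u give v u.
Definition receives v := \sum_u give u v.

Lemma tstar_deg u : tstar u -> deg u = 3.
Proof. by case/and3P=> /eqP. Qed.

Lemma give_deg v u : give v u != 0 -> (2 <= deg v) && (2 <= deg u).
Proof.
rewrite /give; case: (e v u) => //=; case: ifP => [v4|_].
  rewrite (leq_trans _ v4) //=; case: (deg u =P 2) => [->//|_].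
  by case tu: (tstar u) => // _; rewrite (tstar_deg tu).
by case: ifP => // /andP[/tstar_deg-> /eqP->].
Qed.

Lemma no_leaves v : deg v <= 4 -> #|leaves v| = 0.
Proof.
move=> v4; apply/eqP; rewrite cards_eq0; apply/eqP/setP => u; rewrite !inE.
apply/negP => /andP[evu /eqP du]; have := leaf_nbr_deg evu du.
by rewrite ltnNge v4.
Qed.

Lemma receives_ge2 v x y : x != y -> give x v + give y v <= receives v.
Proof.
move=> xy; rewrite /receives (bigD1 x) //= (bigD1 y) 1?eq_sym //=.
by rewrite addnA leq_addr.
Qed.

(** Without its leaves [v] has initial charge [4 * (deg v - #|leaves v|)], and 12 stands for average
    degree 3. Written additively to avoid truncated subtraction. *)
Definition charged v :=
  12 + 4 * #|leaves v| + gives v <= 4 * deg v + receives v.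

(** The deficit is 4. It is covered by 2 + 2, or by 4 from a single large neighbour; two small
    neighbours are ruled out by [deg2_nbr]. *)
Lemma charged_deg2 v : deg v = 2 -> charged v.
Proof.
move=> dv; rewrite /charged no_leaves ?dv // muln0 addn0.
have -> : gives v = 0.
  rewrite /gives big1 // => u _; rewrite /give dv /=; case: (e v u) => //=.
  by case tv: (tstar v) => //=; have := tstar_deg tv; rewrite dv.
have /card_gt0P[x] : 0 < #|nbr v| by rewrite -/(deg v) dv.
rewrite inE => evx; have exv : e x v by rewrite e_sym.
have [evy yx uniq_y] := otherP exv dv; set y := other x v in evy yx uniq_y.
have eyv : e y v by rewrite e_sym.
have oyv : other y v = x.
  have [evo oy _] := otherP eyv dv; apply/eqP; apply: contraNT oy => ox.
  by rewrite (uniq_y _ evo ox).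
have xy : x != y by rewrite eq_sym.
rewrite addn0 -[12]/(8 + 4) leq_add2l; apply: leq_trans (receives_ge2 v xy).
rewrite /give exv eyv dv eqxx /= -/y oyv !andbT.
have [dx|dx] := leqP 4 (deg x); have [dy|dy] := leqP 4 (deg y) => //=.
- by case: (tstar y).
- by case: (tstar x).
- by have := deg2_nbr dv evx evy xy dx; rewrite leqNgt dy.
Qed.

Lemma charged_deg3 v : deg v = 3 -> charged v.
Proof.
move=> dv; rewrite /charged no_leaves ?dv // muln0 addn0 leq_add2l.
have [tv|tv] := boolP (tstar v); last first.
  rewrite /gives big1 // => u _; rewrite /give dv (negPf tv) /=.
  by case: (e v u).
have [/cards1P[u uE] /cards2P[x [y [xy xyE]]]] :
    #|[set y in nbr v | deg y == 2]| == 1 /\ #|[set y in nbr v | 4 <= deg y]| == 2.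
  by case/and3P: tv.
have hv z : z \in [set x; y] -> give z v = 1.
  rewrite -xyE !inE => /andP[evz dz]; rewrite /give e_sym evz dz dv tv //.
apply: leq_trans (receives_ge2 v xy); rewrite !hv ?inE ?eqxx ?orbT //.
rewrite /gives (bigD1 u) //= big1 ?addn0.
  by rewrite /give dv tv; case: (e v u) => //; case: ifP.
move=> z zu; rewrite /give dv tv /=; case evz: (e v z) => //=; case: eqP => // dz.
by have := in_set1 z u; rewrite -uE !inE evz dz eqxx (negPf zu).
Qed.

(** The 2-neighbours that take 4 instead of 2 from a vertex of degree at least 4. *)
Definition costly v := [set u in bad2 v | ~~ tstar (other v u)].

Lemma gives_le v : 4 <= deg v ->
  gives v <= 2 * #|costly v| + 2 * #|bad2 v| + 2 * #|good2 v| + #|tstars v|.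
Proof.
move=> v4; have ind (A : {set V}) : #|A| = \sum_u (u \in A : nat).
  by rewrite -sum1_card big_mkcond; apply: eq_bigr => u _; case: (u \in A).
rewrite !ind !big_distrr -!big_split /=; apply: leq_sum => u _.
rewrite /give !inE v4; case: (e v u) => //=; case: eqP => [du|_] /=.
  by case: leqP => _; case: (tstar (other v u)); case: (tstar u).
by case: (tstar u).
Qed.

Lemma card_weak v : #|weak v| = #|leaves v| + #|bad2 v|.
Proof.
rewrite cardsU; suff -> : leaves v :&: bad2 v = set0 by rewrite cards0 subn0.
apply/setP => u; rewrite !inE; case: (e v u) => //=.
by case: eqP => //= ->.
Qed.

Lemma costly_bad v : #|costly v| <= #|bad2 v|.
Proof. by apply: subset_leq_card; apply/subsetP => u; rewrite inE => /andP[]. Qed.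

Lemma heavy_solid v : #|heavy v| <= #|solid v|.
Proof.
apply: subset_leq_card; apply/subsetP => u; rewrite !inE => /andP[-> du] /=.
by rewrite ltnW //=; apply: contraTN du => /tstar_deg->.
Qed.

Lemma nbr_cases v y : e v y -> y \notin weak v -> y \notin solid v ->
  tstar y \/ y \in good2 v.
Proof.
move=> evy; rewrite !inE evy /= => yw ys.
have [ty|nty] := boolP (tstar y); first by left.
right; move: yw ys (nbr_gt0 evy); rewrite nty andbT.
by case: (deg y) => [|[|[|n]]] //=; rewrite -ltnNge.
Qed.

Lemma weak_few_all v : 4 <= deg v -> 0 < #|weak v| ->
  #|weak v| * (D - deg v) < #|good2 v| + #|solid v|.
Proof.
move=> v4 t0; suff lt : #|weak v| * (D - deg v) < #|good2 v :|: solid v|.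
  exact: leq_trans lt (leq_card_setU _ _).
apply: weak_few => // y evy yw; rewrite in_setU negb_or => /andP[yg ys]; left.
by have [//|yg'] := nbr_cases evy yw ys; rewrite yg' in yg.
Qed.

(** For [K < 'C(deg v, 2)] a 2-neighbour cannot reach the sum of [v], so the good ones drop out of
    [Q]. *)
Lemma weak_few_solid v : 4 <= deg v -> 0 < #|weak v| -> K < 'C(deg v, 2) ->
  #|weak v| * (D - deg v) < #|solid v|.
Proof.
move=> v4 t0 far; apply: weak_few => // y evy yw ys.
have [?|] := nbr_cases evy yw ys; first by left.
by rewrite !inE => /and3P[_ /eqP]; right.
Qed.

(** The surplus is 4. Good 2-neighbours number at most two and exclude bad ones and [tstars v].
    Without good ones, a bad neighbour forces three solid ones and is the only one to take charge;
    with neither, each member of [tstars v] takes 1. *)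
Lemma charged_deg4 v : deg v = 4 -> charged v.
Proof.
move=> dv; have v4 : 4 <= deg v by rewrite dv.
have a0 : #|leaves v| = 0 by rewrite no_leaves // dv.
have := gives_le v4; have := costly_bad v; have := no_three_good dv.
have := nbr_partition v; have := weak_few_all v4; rewrite card_weak a0 add0n dv.
have gP : 0 < #|good2 v| -> #|bad2 v| = 0 /\ #|tstars v| = 0.
  case/card_gt0P=> g gG; split; apply/eqP; rewrite cards_eq0; apply/eqP/setP => u;
    rewrite in_set0; apply/negP => uB; apply: (no_mixed_pair dv _ gG (u := u));
    by rewrite in_setU uB ?orbT.
rewrite /charged a0 dv; move: D6 gP; clear.
move: #|bad2 v| #|good2 v| #|tstars v| #|solid v| #|costly v| (gives v) (receives v).
move=> b g t r k x y D6 gP few part g2 kb xle.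
have [g0|g0] := posnP g; last by have [? ?] := gP g0; lia.
have [b0|b0] := posnP b; first by lia.
have : b * 2 <= b * (D - 4) by rewrite leq_mul2l; lia.
by have := few b0; lia.
Qed.

(** Without weak neighbours each neighbour takes at most 2, which fits unless [deg v = 5] and none
    is solid, the case of [not_all_good]. Otherwise solid neighbours, which take nothing, outnumber
    the weak ones, which cost at most 4 each, so the mean cost is below 2. *)
Lemma charged_mid v : 5 <= deg v < D -> charged v.
Proof.
move=> /andP[v5 vD]; have v4 : 4 <= deg v by exact: ltnW.
have := gives_le v4; have := costly_bad v; have := nbr_partition v.
have := weak_few_all v4; have := weak_few_solid v4.
have all_good : deg v = 5 -> #|weak v| = 0 -> #|solid v| = 0 -> False.
  move=> dv /cards0_eq w0 /cards0_eq s0; apply: (@not_all_good v); first by rewrite dv.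
  apply/subsetP => y; rewrite inE => evy; rewrite in_setU.
  have yw : y \notin weak v by rewrite w0 in_set0.
  have ys : y \notin solid v by rewrite s0 in_set0.
  have [ty|-> //] := nbr_cases evy yw ys.
  by apply/orP; right; rewrite !inE evy ty.
have := mul_bin_diag (deg v) 1; rewrite bin1.
rewrite /charged /K card_weak; move: v5 vD all_good; rewrite card_weak; clear.
move: #|bad2 v| #|good2 v| #|tstars v| #|solid v| #|costly v| (gives v) (receives v).
move: #|leaves v| (deg v) 'C(deg v, 2).
move=> a d C b g t r k x y d5 dD all_good CE few2 few1 part kb xle.
have [t0|t0] := posnP (a + b).
  have [d6|d6] := leqP 6 d; first by lia.
  have dE : d = 5 by lia.
  have [r0|r0] := posnP r; last by lia.
  by case: (all_good dE t0 r0).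
have [CK|CK] := ltnP D.+1 C.
  have : a + b <= (a + b) * (D - d) by rewrite leq_pmulr // subn_gt0.
  by have := few2 t0 CK; move: (_ * _) => m; lia.
(* Now [D + 1 >= 'C(d, 2)] gives [D - d >= d - 1], so [few1] demands [d] neighbours besides the weak
   ones: a contradiction. *)
have h5 : 5 * d.-1 <= d * d.-1 by rewrite leq_mul2r d5 orbT.
have : D - d <= (a + b) * (D - d) by rewrite leq_pmull.
by have := few1 t0; move: ((a + b) * _) => m; lia.
Qed.

(** As [D >= 6], a mean cost of 2 per neighbour is affordable. If heavy neighbours outnumber the
    weak ones, they offset the extra 2 of each. Otherwise there are no leaves and at most one costly
    neighbour, offset by the heavy one from [max_deg_heavy]. *)
Lemma charged_max v : deg v = D -> charged v.
Proof.
move=> dv; have v4 : 4 <= deg v by rewrite dv; move: D6; clear; lia.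
have := gives_le v4; have := costly_bad v; have := nbr_partition v.
have := heavy_solid v; have := max_deg_heavy dv.
have tight : #|heavy v| <= #|weak v| -> #|leaves v| = 0 /\ #|costly v| <= 1.
  move=> few; split.
    apply/eqP; rewrite cards_eq0; apply/eqP/setP => u; rewrite in_set0.
    apply/negP => uL; have uW : u \in weak v by rewrite in_setU uL.
    have [du _ _] := max_deg_weak dv few uW.
    by move: uL; rewrite inE du andbF.
  rewrite leqNgt; apply/negP => /card_gt1P[u1 [u2 []]].
  rewrite ![_ \in costly v]inE => /andP[u1B nt1] /andP[u2B nt2] u12.
  have w1 : u1 \in weak v by rewrite in_setU u1B orbT.
  have w2 : u2 \in weak v by rewrite in_setU u2B orbT.
  have d2 u : u \in weak v -> ~~ tstar (other v u) -> deg (other v u) = 2.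
    move=> uW; apply: contraNeq; exact: max_deg_other_tstar.
  by apply: (max_deg_two_paths dv few w1 w2 u12); exact: d2.
rewrite /charged dv; move: D6 tight; rewrite card_weak; clear.
move: #|bad2 v| #|good2 v| #|tstars v| #|solid v| #|costly v| (gives v) (receives v).
move: #|leaves v| #|heavy v|.
move=> a q b g t r k x y D6 tight hq qr part kb xle.
have [t0|t0] := posnP (a + b); first by lia.
have := hq t0; have [few|many] := leqP q (a + b); last by lia.
by have [a0 k1] := tight few; lia.
Qed.

Lemma all_charged v : 2 <= deg v -> charged v.
Proof.
move=> dv; have [d3|d3] := leqP (deg v) 3.
  have [|d2] := eqVneq (deg v) 3; first exact: charged_deg3.
  by apply: charged_deg2; move: dv d2 d3; clear; lia.
have [|d4] := eqVneq (deg v) 4; first exact: charged_deg4.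
have [|d5] := eqVneq (deg v) D; first exact: charged_max.
by apply: charged_mid; have := degD v; move: d3 d4 d5; clear; lia.
Qed.

Lemma card_arcs_in (S : {set V}) :
  #|arcs_in e S| = \sum_(v in S) #|nbr v :&: S|.
Proof.
transitivity (\sum_v \sum_u (if (v, u) \in arcs_in e S then 1 else 0)).
  by rewrite pair_bigA -sum1_card big_mkcond; apply: eq_bigr => -[].
rewrite [RHS]big_mkcond; apply: eq_bigr => v _; case vS: (v \in S); last first.
  by rewrite big1 // => u _; rewrite inE /= vS.
rewrite -sum1_card [RHS]big_mkcond; apply: eq_bigr => u _.
by rewrite !inE /= vS /= [in RHS]andbC.
Qed.

Lemma no_minimal_noncolourable : False.
Proof.
pose S := [set v | 2 <= deg v].
(* Sparseness speaks of nonempty sets only. If all degrees are at most 1, [leaf_nbr_deg] leaves no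
   edge at all. *)
have [S0|SN] := eqVneq S set0.
  apply: (min_noncolourable e_min); exists (fun _ _ => 0).
  have noedge a b : ~~ e a b.
    apply/negP => eab; have nS x : deg x <= 1.
      by rewrite leqNgt; apply/negP => dx; have := in_set0 x; rewrite -S0 inE dx.
    have da : deg b = 1 by have := nbr_gt0 eab; have := nS b; clear; lia.
    by have := leq_trans (leaf_nbr_deg eab da) (nS a).
  by split=> [|a b]; rewrite ?(negPf (noedge a b)) //; split=> // a b; rewrite (negPf (noedge a b)).
have := e_sparse SN; rewrite card_arcs_in ltnNge => /negP[].
have nS v : #|nbr v :&: S| = deg v - #|leaves v|.
  rewrite /valence -(cardsID S (nbr v)) addnC; apply/esym.
  suff -> : leaves v = nbr v :\: S by rewrite addKn.
  apply/setP => u; rewrite !inE; case evu: (e v u); rewrite ?andbF //=.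
  by have := nbr_gt0 evu; rewrite andbT; case: (deg u) => [|[|n]].
have lv v : #|leaves v| <= deg v.
  by apply: subset_leq_card; apply/subsetP => u; rewrite inE => /andP[].
have out v : v \notin S -> gives v = 0.
  rewrite inE => nv; rewrite /gives big1 // => u _.
  by apply/eqP/negPn; apply: contra nv => /give_deg/andP[].
have inn v : v \notin S -> receives v = 0.
  rewrite inE => nv; rewrite /receives big1 // => u _.
  by apply/eqP/negPn; apply: contra nv => /give_deg/andP[].
have restrict (f : V -> nat) : (forall v, v \notin S -> f v = 0) ->
    \sum_(v in S) f v = \sum_v f v.
  move=> f0; rewrite big_mkcond; apply: eq_bigr => v _.
  by case: ifPn => // /f0.
have balance : \sum_(v in S) gives v = \sum_(v in S) receives v.
  by rewrite !restrict // /gives /receives exchange_big.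
have le v : v \in S ->
    12 + gives v <= 4 * #|nbr v :&: S| + receives v.
  rewrite inE => dv; have := all_charged dv; rewrite /charged nS.
  by have := lv v; move: (gives v) (receives v) #|leaves v| (deg v); clear; lia.
have : \sum_(v in S) (12 + gives v) <=
    \sum_(v in S) (4 * #|nbr v :&: S| + receives v) by exact: leq_sum.
have -> : \sum_(v in S) (4 * #|nbr v :&: S| + receives v) =
    4 * \sum_(v in S) #|nbr v :&: S| + \sum_(v in S) receives v.
  by rewrite big_split big_distrr.
rewrite big_split /= balance leq_add2r sum_nat_const.
by move: #|S| (\sum_(v in S) _); clear; lia.
Qed.

End Minimal.

(** * From relations to graphs *)

Theorem sparse_colourable (V : finType) (D : nat) (e : rel V) : 6 <= D ->
  symmetric e -> irreflexive e -> (forall v, valence e v <= D) -> sparse e ->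
  colourable D.+1 e.
Proof.
move=> D6; have [n] := ubnP #|arcs e|; elim: n e => // n IHn e lt_n e_sym e_irr dD sp.
apply: NNPP => nc; apply: (@no_minimal_noncolourable V D e D6); split=> //.
move=> e' e'_sym e'_irr dD' sp' fewer; apply: IHn => //.
exact: leq_trans fewer lt_n.
Qed.

Section GraphColouring.
Variable G : sgraph.
Implicit Types (u v : G) (f : {set G}).

Lemma edgesP f :
  reflect (exists u v, adj u v /\ f = [set u; v]) (f \in edges G).
Proof.
rewrite inE; apply: (iffP existsP) => [[u /existsP[v /andP[uv /eqP->]]]|].
  by exists u, v.
by case=> u [v [uv ->]]; exists u; apply/existsP; exists v; rewrite uv eqxx.
Qed.

Lemma edge_at f u : f \in edges G -> u \in f ->
  exists2 v, adj u v & f = [set u; v].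
Proof.
case/edgesP=> a [b [ab ->]] /set2P[]->; first by exists b.
by exists a; [rewrite adj_sym | rewrite setUC].
Qed.

Lemma adj_neq u v : adj u v -> u != v.
Proof. by apply: contraTneq => ->; rewrite adj_irrefl. Qed.

Lemma set2_inj u v (p : G * G) : u != v -> [set u; v] = [set p.1; p.2] ->
  p = (u, v) \/ p = (v, u).
Proof.
case: p => a b /= uv E.
have /set2P ua : u \in [set a; b] by rewrite -E !inE eqxx.
have /set2P va : v \in [set a; b] by rewrite -E !inE eqxx orbT.
case: ua va uv => -> [] ->; rewrite ?eqxx //; by [left | right].
Qed.

(** The bound is applied to the subgraph of all edges inside [S]; each of them carries at most two
    arcs. *)
Lemma mad_sparse : (mad G < 3%:R)%R -> sparse (@adj G).
Proof.
move=> mad3 S S0; pose E := [set f in edges G | f \subset S].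
have subH : subgraph (S, E) && ((S, E).1 != set0).
  rewrite S0 andbT; apply/andP; split=> /=.
    by apply/subsetP => f; rewrite inE => /andP[].
  by apply/forallP => f; apply/implyP; rewrite inE => /andP[].
have : (2%:R * #|E|%:R / #|S|%:R <= mad G)%R.
  exact: (Order.TotalTheory.le_bigmax_cond 0%R
    (fun H : {set G} * {set {set G}} => 2%:R * #|H.2|%:R / #|H.1|%:R : rat)%R subH).
move=> /Order.POrderTheory.le_lt_trans/(_ mad3).
rewrite Num.Theory.ltr_pdivrMr ?Num.Theory.ltr0n ?card_gt0 //.
rewrite -!GRing.natrM Num.Theory.ltr_nat; apply: leq_ltn_trans.
rewrite -sum1_card (partition_big (fun p : G * G => [set p.1; p.2]) (mem E)) /=.
  rewrite mulnC -sum_nat_const; apply: leq_sum => f.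
  rewrite inE => /andP[/edgesP[u [v [uv ->]]] _].
  rewrite sum1_card; apply: leq_trans (_ : #|[set (u, v); (v, u)]| <= 2).
    apply: subset_leq_card; apply/subsetP => p; rewrite unfold_in => /andP[_ /eqP/esym].
    by move=> /(set2_inj (adj_neq uv))[] ->; rewrite !inE eqxx ?orbT.
  by rewrite cards2; case: (_ != _).
case=> a b; rewrite !inE /= => /and3P[aS bS ab]; apply/andP; split.
  by apply/existsP; exists a; apply/existsP; exists b; rewrite ab eqxx.
by apply/subsetP => x /set2P[]->.
Qed.

Section FromPartial.
Variables (K : nat) (c : G -> G -> nat).
Hypothesis c_ok : partial_nsd K (@adj G) c.
Hypothesis c_full : forall u v, adj u v -> c u v != 0.
Hypothesis no_isolated_edge : forall u v : G, ~~ isolated_edge u v.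

(** Both orientations of an edge have the same colour, so the maximum only turns a function of pairs
    into one of sets. *)
Definition edge_colour f := \max_(p : G * G | f == [set p.1; p.2]) c p.1 p.2.

Lemma edge_colourE u v : adj u v -> edge_colour [set u; v] = c u v.
Proof.
move=> uv; apply/eqP; rewrite eqn_leq; apply/andP; split.
  apply/bigmax_leqP => p /eqP/(set2_inj (adj_neq uv))[] -> //=.
  by rewrite (pnsd_sym c_ok).
exact: (@leq_bigmax_cond _ _ (fun p : G * G => c p.1 p.2) (u, v)).
Qed.

Lemma colour_sumE u : colour_sum edge_colour u = total c u.
Proof.
have -> : total c u = \sum_(v in neighbours (@adj G) u) edge_colour [set u; v].
  rewrite [RHS]big_mkcond; apply: eq_bigr => v _; rewrite inE.
  case: ifP => [uv|/negP nuv]; first by rewrite edge_colourE.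
  by apply/eqP/negPn; apply/negP => /(pnsd_edge c_ok).
rewrite -(big_imset (h := fun v => [set u; v])) /=; last first.
  move=> v w; rewrite !inE => uv uw E.
  have /set2P[vu|//] : v \in [set u; w] by rewrite -E !inE eqxx orbT.
  by rewrite vu adj_irrefl in uv.
apply: eq_bigl => f; apply/andP/imsetP => [[fE uf]|[v]].
  by have [v uv ->] := edge_at fE uf; exists v; rewrite ?inE.
rewrite inE => uv ->; split; last by rewrite !inE eqxx.
by apply/edgesP; exists u, v.
Qed.

(** The exemption of leaves is paid back here: the total at [u] is the colour of [uv], and [v] has a
    second edge since [uv] is not isolated. *)
Lemma leaf_total_lt u v : adj u v -> valence (@adj G) u <= 1 ->
  total c u < total c v.
Proof.
move=> uv du; have vu : adj v u by rewrite adj_sym.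
have uN w : adj u w -> w = v.
  move=> uw; apply: contraTeq du => wv; rewrite -ltnNge.
  by apply/card_gt1P; exists w, v; rewrite !inE.
have tu : total c u = c u v.
  rewrite /total (bigD1 v) //= big1 ?addn0 // => w wv.
  apply/eqP/negPn; apply: contraNN wv => /(pnsd_edge c_ok)/uN->.
  by rewrite eqxx.
have [/existsP[w /andP[vw wu]]|] := boolP [exists w, adj v w && (w != u)].
  rewrite tu (pnsd_sym c_ok) /total (bigD1 u) //= (bigD1 w) //=.
  by rewrite -[X in X < _]addn0 ltn_add2l addn_gt0 lt0n c_full.
rewrite negb_exists => /forallP vN; have /negP[] := no_isolated_edge u v.
rewrite /isolated_edge uv; apply/eqP/setP => w; rewrite in_set.
apply/idP/idP => [cuw|/set2P[]->]; [|exact: connect0|exact: connect1].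
have cl x y : adj x y -> x \in [set u; v] -> y \in [set u; v].
  move=> xy /set2P[] xE; rewrite {x}xE in xy.
    by rewrite (uN y xy) !inE eqxx orbT.
  by have := vN y; rewrite xy /= negbK => /eqP->; rewrite !inE eqxx.
rewrite -(closed_connect (a := [set u; v]) _ cuw) ?inE ?eqxx // => x y xy.
apply/idP/idP; first exact: cl.
by apply: cl; rewrite adj_sym.
Qed.

Lemma edge_colour_nsd : nsd_colouring K edge_colour.
Proof.
split; first split.
- move=> f /edgesP[u [v [uv ->]]]; rewrite edge_colourE // lt0n c_full //.
  exact: pnsd_le c_ok u v.
- move=> f g fE gE fg /set0Pn[u /setIP[uf ug]].
  have [v uv fV] := edge_at fE uf; have [w uw gW] := edge_at gE ug.
  rewrite fV gW !edge_colourE //; apply: contraNneq fg => E.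
  by rewrite fV gW (pnsd_proper c_ok E) ?c_full.
move=> u v uv; rewrite !colour_sumE.
have vu : adj v u by rewrite adj_sym.
have [du|du] := leqP (valence (@adj G) u) 1; first by rewrite neq_ltn leaf_total_lt.
have [dv|dv] := leqP (valence (@adj G) v) 1; first by rewrite neq_ltn (leaf_total_lt vu) ?orbT.
by apply: (pnsd_sum c_ok) => // w aw _; exact: c_full.
Qed.

End FromPartial.

Lemma nsd_index_exists k : (exists c, @nsd_colouring G k c) ->
  exists j, nsd_index G j /\ j <= k.
Proof.
have [n] := ubnP k; elim: n k => // n IHn k lt_kn col.
have [[j [lt_jk colj]]|none] :=
    classic (exists j, j < k /\ exists c, @nsd_colouring G j c).
  have [|i [iP ij]] := IHn j _ colj; first exact: leq_trans lt_jk lt_kn.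
  by exists i; split=> //; exact: leq_trans ij (ltnW lt_jk).
exists k; split=> //; split=> // j colj; rewrite leqNgt; apply/negP => lt_jk.
by apply: none; exists j.
Qed.

End GraphColouring.

Theorem theorem7 (G : sgraph)
  (no_isolated_edge : forall u v : G, ~~ isolated_edge u v)
  (Delta_ge6 : 6 <= max_degree G)
  (mad_lt3 : (mad G < 3%:R)%R) :
  exists k : nat, nsd_index G k /\ k <= (max_degree G).+1.
Proof.
have [||v||c [c_ok c_full]] := @sparse_colourable G (max_degree G) (@adj G) Delta_ge6.
- exact: adj_sym.
- exact: adj_irrefl.
- exact: (@leq_bigmax _ (@degree G) v).
- exact: mad_sparse.
by apply: nsd_index_exists; exists (edge_colour c); exact: edge_colour_nsd.
Qed.
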